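(* Let $X$ be a standard Borel space and let $E\subseteq F$ be countable Borel equivalence relations on $X$. If $E$ is essentially free and $E$ has finite index in $F$ (that is, every $F$-class contains only finitely many $E$-classes), then $F$ is essentially free.
   Context: A countable Borel equivalence relation on a standard Borel space $X$ is an equivalence relation $R$ on $X$ that is a Borel subset of $X\times X$ and all of whose equivalence classes are countable. For equivalence relations $R$ on a standard Borel space $X$ and $S$ on a standard Borel space $Y$, a Borel reduction of $R$ to $S$ is a Borel map $f:X\to Y$ such that for all $x,x'\in X$, $x\mathrel{R}x'$ if and only if $f(x)\mathrel{S}f(x')$. One says $R$ is Borel reducible to $S$, written $R\leq_B S$, if such a map exists; $R$ and $S$ are Borel bireducible if $R\leq_B S$ and $S\leq_B R$. A countable Borel equivalence relation is free if it is induced by a free Borel action of a countable (discrete) group, i.e. it is the orbit equivalence relation of a Borel action of a countable group on the underlying standard Borel space in which no non-identity group element fixes any point. A countable Borel equivalence relation is essentially free if it is Borel bireducible with a free countable Borel equivalence relation, or equivalently (a known fact) if it is Borel reducible to a free countable Borel equivalence relation. For countable Borel equivalence relations $E\subseteq F$ on the same standard Borel space, $E$ has finite index in $F$ if each $F$-class contains only finitely many $E$-classes; no uniform bound on the number of $E$-classes per $F$-class is assumed. *)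

(* Defs.v *)
From HB Require Import structures.
From Stdlib Require Import RelationClasses.
From mathcomp Require Import all_boot all_order all_algebra.
From mathcomp Require Import all_classical all_reals all_analysis.

Set Implicit Arguments.
Unset Strict Implicit.
Unset Printing Implicit Defensive.

Local Open Scope classical_set_scope.

(* `completeType` and its descendants are pointed; the underlying property is
   spelled out here so that the empty space counts as Polish. *)
Definition polish_metric (R : realType) (M : metricType R) : Prop :=
  (exists2 D : set M, countable D & dense D) /\
  (forall F : set_system M, ProperFilter F -> cauchy F -> exists l : M, F --> l).

(* A set with a family of subsets that is, up to a bijection, the Borel
   sigma-algebra of a Polish space. `measurableType` is not used as the carrier
   because it is pointed, which would exclude the empty space. *)
Record standardBorelType (R : realType) := StandardBorelType {
  sb_sort :> Type ;
  borel : set (set sb_sort) ;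
  borel_polish : exists (M : metricType R) (f : sb_sort -> M),
    [/\ polish_metric M, bijective f &
        borel = [set f @^-1` B | B in <<s @open M >>]]
}.
Arguments borel {R} X : rename.

Definition prod_sigma_algebra (T1 T2 : Type)
    (S1 : set (set T1)) (S2 : set (set T2)) : set (set (T1 * T2)) :=
  <<s [set A `*` B | A in S1 & B in S2] >>.

Section BorelEquivalenceRelations.
Context {R : realType}.
Implicit Types X Y : standardBorelType R.

Definition borel_map X Y (f : X -> Y) : Prop :=
  forall B, borel Y B -> borel X (f @^-1` B).

(* For standard Borel spaces the Borel subsets of the product are the members of
   the product sigma-algebra. *)
Record cber X (E : X -> X -> Prop) : Prop := CBER {
  cber_equiv : Equivalence E ;
  cber_borel :
    prod_sigma_algebra (borel X) (borel X) [set p | E p.1 p.2] ;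
  cber_countable : forall x, countable [set y | E x y]
}.

Definition borel_reduction X Y (E : X -> X -> Prop) (S : Y -> Y -> Prop)
    (f : X -> Y) : Prop :=
  borel_map f /\ forall x x', E x x' <-> S (f x) (f x').

Definition borel_reducible X Y (E : X -> X -> Prop) (S : Y -> Y -> Prop) : Prop :=
  exists f : X -> Y, borel_reduction E S f.

Definition borel_bireducible X Y (E : X -> X -> Prop) (S : Y -> Y -> Prop) : Prop :=
  borel_reducible E S /\ borel_reducible S E.

(* The group is discrete: all of its subsets are Borel. *)
Record free_borel_action (G : groupType) X (act : G -> X -> X) : Prop :=
  FreeBorelAction {
  act1 : forall x, act 1%g x = x ;
  actM : forall g h x, act (g * h)%g x = act g (act h x) ;
  act_borel : forall B, borel X B ->
    prod_sigma_algebra [set: set G] (borel X) [set p | B (act p.1 p.2)] ;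
  act_free : forall g x, act g x = x -> g = 1%g
}.

Definition free_cber X (E : X -> X -> Prop) : Prop :=
  cber E /\
  exists (G : groupType) (act : G -> X -> X),
    [/\ countable [set: G], free_borel_action act &
        forall x y, E x y <-> exists g, act g x = y].

Definition essentially_free X (E : X -> X -> Prop) : Prop :=
  exists (Y : standardBorelType R) (S : Y -> Y -> Prop),
    free_cber S /\ borel_bireducible E S.

Definition finite_index X (E F : X -> X -> Prop) : Prop :=
  forall x, finite_set [set [set z | E y z] | y in [set y | F x y]].

End BorelEquivalenceRelations.

(* Main.v *)
Require Import Defs.
From mathcomp Require Import all_boot all_order all_algebra.
From mathcomp Require Import all_classical all_reals all_analysis.
From HB Require Import structures.
From Stdlib Require Cantor.

(** Let f reduce E to the orbit equivalence relation of a free Borel action of a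
countable group G on Y.  Suppose first that every F-class consists of exactly
n classes of E, and let x_1, ..., x_n represent the E-classes inside the
F-class of x.  The tuple (f x_1, ..., f x_n) is determined by the F-class up
to the action of the wreath product of G by the symmetric group, and that
action is free at such tuples: the entries lie in distinct G-orbits, so an
element fixing the tuple cannot permute the entries, and it cannot move an
entry inside its orbit because G acts freely.  Thus F reduces to the orbit
equivalence relation of an action that is free on the image.

To treat all finite indices at once the tuples are padded with dummy orbits.
[frame x] is an injective G-equivariant map from G * nat to the disjoint union
of Y and G * nat; its image consists of the G-orbits met by f on the F-class
of x together with the whole second summand.  Two frames of the same F-class
have the same image, so they differ by an equivariant permutation of G * nat,
and this permutation has finite support because both frames use the same
finite number of orbits in Y ([frame_tail], [frame_perm]).  The finitely
supported equivariant permutations form a countable group [finperm G]; it acts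
on all maps out of G * nat by precomposition, freely at injective maps.

It remains to pass from such a reduction b to bireducibility with a free
action on a standard Borel space ([essentially_free_of_action]).  The space is
the saturation of the image of b, and a reduction back chooses a b-preimage up
to the action.  That the saturation is Borel and the choice can be made Borel
is the Lusin-Novikov theorem ([lusin_novikov]): a Borel set with countable
sections is covered by the graphs of countably many Borel functions.  The same
theorem enumerates the F-class of x in a Borel way ([cber_enum]), which is what
makes [frame] a Borel map.

Everything is carried out in the Baire space.  A standard Borel space is the
same as a set with a sigma-algebra that is [coded], that is, isomorphic to the
trace of the Borel sets on a Borel subset of the Baire space.  In one direction
a point of a Polish space is coded by the indices of the points of a dense
sequence that are close to it.  In the other, every Borel set is the injective
projection of a closed set, with a Borel inverse ([borel_closed_graph]), and
closed subsets of the Baire space are Polish.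

The proof of the Lusin-Novikov theorem rests on the fact that an analytic
relation that is a partial function lies in the graph of a Borel function
([analytic_functional], a consequence of the separation of disjoint analytic
sets).  Write the Borel set as a projection of a closed set, and consider
finite sets of nodes (finite sequences) that describe simultaneous
approximations to several points over one x.  There are only countably many of
them, so countably many Borel functions suffice to kill every one that can be
killed at all ([exists_saturated]).  If some point of the set escaped these
functions, then a surviving configuration could always be refined so that each
of its nodes splits into two ([live_split]): otherwise the points under that
node would form a partial function, and its graph could have been removed too.
Iterating gives a single x and a tree of splitting nodes over it, and a branch
that avoids a given enumeration of the section at x ([saturated_covers]). *)

Set Implicit Arguments.
Unset Strict Implicit.
Unset Printing Implicit Defensive.
Import Order.TTheory GRing.Theory Num.Theory.
Local Open Scope classical_set_scope.

(** * Sigma-algebras and the Borel sets of the Baire space *)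

Section SigmaAlgebra.
Variables (T : Type) (S : set (set T)).
Hypothesis hS : sigma_algebra setT S.

Lemma sa_ext (A B : set T) : (forall x, A x <-> B x) -> S A -> S B.
Proof. by move=> AB; have -> : A = B by apply/predeqP. Qed.

Lemma sa_not (A : set T) : S A -> S (fun x => ~ A x).
Proof.
case: hS => _ hC _ /hC; apply: sa_ext => x; split; first by case.
by move=> nA; split.
Qed.

Lemma sa_ex (A : nat -> set T) : (forall n, S (A n)) ->
  S (fun x => exists n, A n x).
Proof.
case: hS => _ _ hU /hU; apply: sa_ext => x; split; first by case=> n _; exists n.
by case=> n Anx; exists n.
Qed.

Lemma sa_all (A : nat -> set T) : (forall n, S (A n)) ->
  S (fun x => forall n, A n x).
Proof.
move=> SA; have := sa_not (sa_ex (fun n => sa_not (SA n))).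
apply: sa_ext => x; split=> [H n|H [n]]; last by apply.
by apply: contrapT => nA; apply: H; exists n.
Qed.

Lemma sa_cst (P : Prop) : S (fun=> P).
Proof.
case: hS => S0 _ _; case: (pselect P) => hP.
  by have := sa_not S0; apply: sa_ext => x; split=> // _ [].
by move: S0; apply: sa_ext.
Qed.

Lemma sa_or (A B : set T) : S A -> S B -> S (fun x => A x \/ B x).
Proof.
move=> SA SB; have : forall n, S (if n is 0 then A else B) by case.
move/sa_ex; apply: sa_ext => x; split; first by case=> -[|n]; [left|right].
by case=> H; [exists 0|exists 1].
Qed.

Lemma sa_and (A B : set T) : S A -> S B -> S (fun x => A x /\ B x).
Proof.
move=> SA SB; have : forall n, S (if n is 0 then A else B) by case.
move/sa_all; apply: sa_ext => x; split=> [H|[Ax Bx] [|n]//].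
by split; [exact: (H 0)|exact: (H 1)].
Qed.

(** Countable unions over an arbitrary index type, by regrouping along an
    injection into nat. *)
Lemma sa_exC (I : Type) (A : I -> set T) : countable [set: I] ->
  (forall i, S (A i)) -> S (fun x => exists i, A i x).
Proof.
move=> /countable_injP[c ic] SA.
pose B n : set T := fun x => exists i, c i = n /\ A i x.
have SB n : S (B n).
  case: (pselect (exists i, c i = n)) => [[i ci]|ni].
    move: (SA i); apply: sa_ext => x; split=> [Ax|[j [cj Aj]]]; first by exists i.
    by rewrite (ic i j) ?in_setT// ci cj.
  move: (sa_cst False); apply: sa_ext => x; split=> // -[i [ci _]].
  by apply: ni; exists i.
move: (sa_ex SB); apply: sa_ext => x; split; first by case=> n [i [_ Ax]]; exists i.
by case=> i Ax; exists (c i), i.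
Qed.

End SigmaAlgebra.

Lemma sa_preimage (T U : Type) (S : set (set T)) (f : T -> U) :
  sigma_algebra setT S -> sigma_algebra setT [set B | S (f @^-1` B)].
Proof.
move=> hS; split=> /=.
- exact: sa_cst.
- by move=> A SA; apply: sa_ext (sa_not hS SA) => x; split=> // -[].
- move=> A SA; apply: sa_ext (sa_ex hS SA) => x; split.
    by case=> n; exists n.
  by case=> n _; exists n.
Qed.

Lemma sa_generated_preimage (T U : Type) (S : set (set T)) (f : T -> U) (G : set (set U)) :
  sigma_algebra setT S -> (forall B, G B -> S (f @^-1` B)) ->
  forall B, <<s G >> B -> S (f @^-1` B).
Proof.
by move=> hS GS B; apply: (smallest_sub (sa_preimage f hS)).
Qed.

Definition baire := nat -> nat.

Definition borelN : set (set baire) :=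
  <<s [set A | exists n m, A = [set x : baire | x n = m]] >>.

Lemma borelN_sa : sigma_algebra setT borelN.
Proof. exact: smallest_sigma_algebra. Qed.

Definition borel_fun T (S : set (set T)) (f : T -> baire) :=
  forall n m, S (fun t => f t n = m).

Lemma borel_fun_id : borel_fun borelN (fun x => x).
Proof. by move=> n m; apply: sub_sigma_algebra; exists n, m. Qed.

Section BorelFun.
Variables (T : Type) (S : set (set T)).
Hypothesis hS : sigma_algebra setT S.

Lemma borel_fun_preimage f A : borel_fun S f -> borelN A -> S (fun t => A (f t)).
Proof.
by move=> bf; apply: (sa_generated_preimage hS (f := f)) => B [n [m ->]]; exact: bf.
Qed.

Lemma borel_fun_comp f g : borel_fun S f -> borel_fun borelN g -> borel_fun S (fun t => g (f t)).
Proof. by move=> bf bg n m; exact: (borel_fun_preimage bf (bg n m)). Qed.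

Lemma borel_fun_reidx f (r : nat -> nat) : borel_fun S f -> borel_fun S (fun t n => f t (r n)).
Proof. by move=> bf n m; exact: bf. Qed.

Lemma borel_fun_eq f g : borel_fun S f -> borel_fun S g -> S (fun t => f t = g t).
Proof.
move=> bf bg; have : S (fun t => forall n, exists m, f t n = m /\ g t n = m).
  by apply: sa_all => // n; apply: sa_ex => // m; apply: sa_and.
apply: sa_ext => t; split=> [H|-> n]; last by exists (g t n).
by apply/funext => n; case: (H n) => m [-> ->].
Qed.

Lemma borel_fun_cst (x : baire) : borel_fun S (fun=> x).
Proof. by move=> n m; exact: sa_cst. Qed.

End BorelFun.

(** Interleaving is a homeomorphism from the square of the Baire space to the
    Baire space, so that Borel sets of pairs can be written with
    [borelN] alone. *)
Definition join (x y : baire) : baire :=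
  fun n => if odd n then y n./2 else x n./2.
Definition evens (z : baire) : baire := fun n => z n.*2.
Definition odds (z : baire) : baire := fun n => z n.*2.+1.

Lemma evens_join x y : evens (join x y) = x.
Proof. by apply/funext=> n; rewrite /evens /join odd_double doubleK. Qed.

Lemma odds_join x y : odds (join x y) = y.
Proof.
by apply/funext=> n; rewrite /odds /join oddS odd_double /= uphalf_double.
Qed.

Lemma join_evens_odds z : join (evens z) (odds z) = z.
Proof.
apply/funext=> n; rewrite /join /evens /odds -[in RHS](odd_double_half n).
by case: (odd n).
Qed.

Lemma borel_fun_evens T (S : set (set T)) f : borel_fun S f -> borel_fun S (fun t => evens (f t)).
Proof. exact: borel_fun_reidx. Qed.

Lemma borel_fun_odds T (S : set (set T)) f : borel_fun S f -> borel_fun S (fun t => odds (f t)).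
Proof. exact: (borel_fun_reidx (fun n => n.*2.+1)). Qed.

Lemma borel_fun_join T (S : set (set T)) f g : borel_fun S f -> borel_fun S g ->
  borel_fun S (fun t => join (f t) (g t)).
Proof. by move=> bf bg n m; rewrite /join; case: (odd n). Qed.

Definition column (i : nat) (z : baire) : baire := fun j => z (Cantor.to_nat (i, j)).
Definition glue (z : nat -> baire) : baire :=
  fun n => z (Cantor.of_nat n).1 (Cantor.of_nat n).2.

Lemma column_glue z i : column i (glue z) = z i.
Proof. by apply/funext => j; rewrite /column /glue Cantor.cancel_of_to. Qed.

Lemma glue_column z : glue (column^~ z) = z.
Proof.
apply/funext => n; rewrite /column /glue -surjective_pairing.
by rewrite Cantor.cancel_to_of.
Qed.

Definition agree (T : Type) n (x y : nat -> T) := forall i, (i < n)%N -> x i = y i.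

Lemma agree_le (T : Type) n m (x y : nat -> T) : (m <= n)%N -> agree n x y -> agree m x y.
Proof. by move=> mn a i im; apply: a; apply: leq_trans mn. Qed.

Lemma agree_all (x y : baire) : (forall n, agree n x y) -> x = y.
Proof. by move=> a; apply/funext => i; exact: (a i.+1 i). Qed.

Lemma agree_evens n x y : agree n.*2 x y -> agree n (evens x) (evens y).
Proof. by move=> a i ni; apply: a; rewrite ltn_double. Qed.

Lemma agree_odds n x y : agree n.*2 x y -> agree n (odds x) (odds y).
Proof. by move=> a i ni; apply: a; rewrite ltn_Sdouble. Qed.

Lemma agree_join n x y x' y' : agree n x x' -> agree n y y' -> agree n (join x y) (join x' y').
Proof.
move=> ax ay i ni; rewrite /join; have i2 : (i./2 < n)%N.
  by apply: leq_ltn_trans ni; rewrite leq_half_double leqW// -addnn leq_addr.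
by case: (odd i); [apply: ay|apply: ax].
Qed.

(** Closedness in the square of the Baire space: membership is decided by
    finite approximations. *)
Definition closed2 (C : baire -> baire -> Prop) := forall x u,
  (forall n, exists x' u', [/\ agree n x x', agree n u u' & C x' u']) -> C x u.

Lemma agree_column i n : exists m, forall x y, agree m x y -> agree n (column i x) (column i y).
Proof.
elim: n => [|n [m hm]]; first by exists 0 => x y _ j.
exists (maxn m (Cantor.to_nat (i, n)).+1) => x y a j; rewrite ltnS leq_eqVlt.
case/orP => [/eqP->|jn].
  by apply: a; rewrite leq_max leqnn orbT.
by apply: (hm x y) => //; apply: agree_le a; rewrite leq_max leqnn.
Qed.

(** An injective projection of a closed set, with a Borel inverse w.  Keeping w,
    rather than mere existence of a witness, is what later makes a Borel set
    isomorphic, and not just in bijection, with a closed set. *)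
Definition closed_graph (A : set baire) := exists C w,
  [/\ closed2 C, borel_fun borelN w & forall x u, C x u <-> A x /\ u = w x].

Lemma closed_graph_ext A B : (forall x, A x <-> B x) ->
  closed_graph A -> closed_graph B.
Proof. by move=> AB; have -> : A = B by apply/predeqP. Qed.

(** The hypothesis says that membership depends on the first n terms only; the
    constant witness 0 then works. *)
Lemma closed_graph_clopen (P : baire -> Prop) :
  (exists n, forall x y, agree n x y -> P x -> P y) -> closed_graph P.
Proof.
move=> [n hP]; exists (fun x u => P x /\ u = (fun=> 0)), (fun=> fun=> 0); split.
- move=> x u H; split.
    by case: (H n) => x' [u' [ax _ [Px _]]]; apply: hP Px => i /ax.
  apply/funext => i; case: (H i.+1) => x' [u' [_ au [_ u0]]].
  by rewrite (au i)// u0.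
- exact: borel_fun_cst borelN_sa _.
- by [].
Qed.

(** A witness for a countable intersection is a sequence of witnesses, coded as
    the columns of one element of the Baire space. *)
Lemma closed_graph_all (A : nat -> set baire) :
  (forall n, closed_graph (A n)) -> closed_graph (fun x => forall n, A n x).
Proof.
move=> cA; pose C n := projT1 (cid (cA n)).
have cC n : exists w, [/\ closed2 (C n), borel_fun borelN w &
  forall x u, C n x u <-> A n x /\ u = w x] := projT2 (cid (cA n)).
pose w n := projT1 (cid (cC n)).
have hw n : [/\ closed2 (C n), borel_fun borelN (w n) &
  forall x u, C n x u <-> A n x /\ u = w n x] := projT2 (cid (cC n)).
exists (fun x u => forall n, C n x (column n u)), (fun x => glue (w^~ x)); split.
- move=> x u H n; case: (hw n) => cl _ _; apply: cl => k.
  case: (agree_column n k) => m hm.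
  case: (H (maxn m k)) => x' [u' [ax au /(_ n) Cu]]; exists x', (column n u').
  split=> //; first by apply: agree_le ax; rewrite leq_maxr.
  by apply: hm; apply: agree_le au; rewrite leq_maxl.
- by move=> n m; rewrite /glue; case: (hw (Cantor.of_nat n).1) => _ + _; apply.
- move=> x u; split=> [H|[Ax ->] n].
    split=> [n|]; first by case: (hw n) => _ _ /(_ x (column n u)) [/(_ (H n))[]].
    rewrite -[u]glue_column; congr glue; apply/funext => n.
    by case: (hw n) => _ _ /(_ x (column n u)) [/(_ (H n))[]].
  by case: (hw n) => _ _ /(_ x (column n (glue (w^~ x)))) [_]; apply; rewrite column_glue.
Qed.

Lemma closed_graph_and A B : closed_graph A -> closed_graph B ->
  closed_graph (fun x => A x /\ B x).
Proof.
move=> cA cB; have : forall n, closed_graph (if n is 0 then A else B) by case.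
move/closed_graph_all; apply: closed_graph_ext => x; split=> [H|[Ax Bx] [|n]//].
by split; [exact: (H 0)|exact: (H 1)].
Qed.

(** The witness for a disjoint union starts with the index of the piece.
    Disjointness is what keeps it unique. *)
Lemma closed_graph_disj (A : nat -> set baire) :
  (forall n, borelN (A n)) ->
  (forall n m x, A n x -> A m x -> n = m) ->
  (forall n, closed_graph (A n)) -> closed_graph (fun x => exists n, A n x).
Proof.
move=> bA dA cA; pose C n := projT1 (cid (cA n)).
have cC n : exists w, [/\ closed2 (C n), borel_fun borelN w &
  forall x u, C n x u <-> A n x /\ u = w x] := projT2 (cid (cA n)).
pose w n := projT1 (cid (cC n)).
have hw n : [/\ closed2 (C n), borel_fun borelN (w n) &
  forall x u, C n x u <-> A n x /\ u = w n x] := projT2 (cid (cC n)).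
pose tl (u : baire) : baire := fun n => u n.+1.
pose cons n (u : baire) : baire := fun k => if k is k'.+1 then u k' else n.
pose W x := if pselect (exists n, A n x) is left e
  then let n := projT1 (cid e) in cons n (w n x) else fun=> 0.
have WA n x : A n x -> W x = cons n (w n x).
  move=> Ax; rewrite /W; case: pselect => [e|[]]; last by exists n.
  by case: (cid e) => k Ak /=; rewrite (dA _ _ _ Ak Ax).
exists (fun x u => C (u 0) x (tl u)), W; split.
- move=> x u H; case: (hw (u 0)) => cl _ _; apply: cl => k.
  case: (H k.+1) => x' [u' [ax au Cu]]; exists x', (tl u'); split.
  + exact: agree_le ax.
  + by move=> i ik; apply: au.
  + by rewrite (au 0).
- move=> k m.
  have : borelN (fun x => (exists n, A n x /\ cons n (w n x) k = m) \/
      ((~ exists n, A n x) /\ 0 = m)).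
    apply: (sa_or borelN_sa).
      apply: (sa_ex borelN_sa) => n; apply: (sa_and borelN_sa) => //.
      case: k => [|k] /=; first exact: sa_cst borelN_sa _.
      by case: (hw n) => _ + _; apply.
    apply: (sa_and borelN_sa); last exact: sa_cst borelN_sa _.
    exact: (sa_not borelN_sa (sa_ex borelN_sa bA)).
  apply: sa_ext => x; split.
    case=> [[n [Ax <-]]|[nA <-]]; first by rewrite (WA n).
    by rewrite /W; case: pselect.
  move=> Wx; case: (pselect (exists n, A n x)) => [[n Ax]|nA].
    by left; exists n; rewrite -(WA n).
  by right; split => //; move: Wx; rewrite /W; case: pselect.
- move=> x u; split=> [H|[[n Ax] ->]].
    case: (hw (u 0)) => _ _ /(_ x (tl u)) [/(_ H)[Ax tu] _].
    split; first by exists (u 0).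
    by rewrite (WA _ _ Ax) -tu; apply/funext => -[].
  by rewrite (WA _ _ Ax); case: (hw n) => _ _ /(_ x (w n x)) [_]; apply.
Qed.

(** The class of Borel sets A such that both A and its complement have the
    property is a sigma-algebra.  A union is first made disjoint by removing from
    each set the earlier ones, which uses the property for their complements. *)
Lemma borel_closed_graph A : borelN A -> closed_graph A.
Proof.
move=> bA; suff : [set A | [/\ borelN A, closed_graph A & closed_graph (fun x => ~ A x)]] A by case.
apply: (smallest_sub _ _ bA) => [|B [n [m ->]]]; last first.
  split; first exact: borel_fun_id.
    by apply: closed_graph_clopen; exists n.+1 => x y a /= <-; rewrite a.
  by apply: closed_graph_clopen; exists n.+1 => x y a /=; rewrite a.
split=> /=.
- by split; [exact: (sa_cst borelN_sa False)| |]; apply: closed_graph_clopen; exists 0.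
- move=> B [bB cB cnB]; split.
  + by case: borelN_sa => _ + _; apply.
  + by move: cnB; apply: closed_graph_ext => x; split=> [|[]].
  + move: cB; apply: closed_graph_ext => x; split; first by move=> ? [].
    by move=> H; apply: contrapT => nB; apply: H; split.
- move=> B HB.
  have bB n : borelN (B n) by case: (HB n).
  split.
  + by case: borelN_sa => _ _; apply.
  + pose D n x := B n x /\ forall k, (k < n)%N -> ~ B k x.
    have : closed_graph (fun x => exists n, D n x).
      apply: closed_graph_disj.
      * move=> n; apply: (sa_and borelN_sa) => //; apply: (sa_all borelN_sa) => k.
        have := sa_or borelN_sa (sa_cst borelN_sa (~ (k < n)%N)) (sa_not borelN_sa (bB k)).
        apply: sa_ext => x; split; first by case.
        by move=> H; case: (pselect (k < n)%N); [right; apply: H|left].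
      * move=> n m x [Bn hn] [Bm hm]; apply/eqP; rewrite eqn_leq.
        by apply/andP; split; rewrite leqNgt; apply/negP; [move/hn|move/hm].
      * move=> n; apply: closed_graph_and; first by case: (HB n).
        apply: closed_graph_all => k; case: (ltnP k n) => kn.
          by case: (HB k) => _ _; apply: closed_graph_ext => x; split=> // /(_ isT).
        by apply: closed_graph_clopen; exists 0.
    apply: closed_graph_ext => x; split; first by case=> n [Bn _]; exists n.
    case=> n _; elim/ltn_ind: n => n IH Bn.
    case: (pselect (exists2 k, (k < n)%N & B k x)) => [[k kn]|H]; first exact: IH kn.
    by exists n; split=> // k kn Bk; apply: H; exists k.
  + have /closed_graph_all : forall n, closed_graph (fun x => ~ B n x) by move=> n; case: (HB n).
    apply: closed_graph_ext => x; split=> [H [n _]|H n Bn]; first exact: H.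
    by apply: H; exists n.
Qed.

(** * Analytic sets and separation *)

(** The value 0 where no condition holds makes f total, so that it can be
    evaluated at every point when sets are covered by graphs below. *)
Lemma borel_fun_graph T (S : set (set T)) (G : nat -> nat -> set T) :
  sigma_algebra setT S -> (forall n m, S (G n m)) ->
  (forall n m m' t, G n m t -> G n m' t -> m = m') ->
  exists2 f, borel_fun S f & forall n m t, G n m t -> f t n = m.
Proof.
move=> hS SG fG.
pose f t n := if pselect (exists m, G n m t) is left e then projT1 (cid e) else 0.
have fP n m t : G n m t -> f t n = m.
  move=> Gt; rewrite /f; case: pselect => [e|[]]; last by exists m.
  by case: (cid e) => k Gk /=; exact: fG Gk Gt.
exists f => // n m.
have := sa_or hS (SG n m)
  (sa_and hS (sa_not hS (sa_ex hS (SG n))) (sa_cst hS (0 = m))).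
apply: sa_ext => t; split=> [[/fP//|[nG <-]]|ft].
  by rewrite /f; case: pselect.
case: (pselect (exists m, G n m t)) => [[k Gk]|nG].
  by left; rewrite -ft (fP _ _ _ Gk).
by right; split=> //; rewrite -ft /f; case: pselect.
Qed.

Lemma limit_branch (T : Type) (Q : nat -> (nat -> T) -> Prop) a0 : Q 0 a0 ->
  (forall n a, Q n a -> exists b, agree n a b /\ Q n.+1 b) ->
  exists a, forall n, exists b, agree n a b /\ Q n b.
Proof.
move=> Q0 step.
have nxt (n : nat) (a : {a | Q n a}) : {b : {b | Q n.+1 b} | agree n (projT1 a) (projT1 b)}.
  case: a => a Qa; apply: cid; case: (step n a Qa) => b [ab Qb].
  by exists (exist _ b Qb).
pose s : forall n, {a | Q n a} := fix s n :=
  if n is n'.+1 then projT1 (nxt n' (s n')) else exist _ a0 Q0.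
have sS n : agree n (projT1 (s n)) (projT1 (s n.+1)) by exact: (projT2 (nxt n (s n))).
have sm n k i : (i < n)%N -> projT1 (s n) i = projT1 (s (n + k)) i.
  elim: k => [|k IH] ni; first by rewrite addn0.
  by rewrite IH// addnS; apply: sS; rewrite ltn_addr.
exists (fun i => projT1 (s i.+1) i) => n; exists (projT1 (s n)).
split; last exact: (projT2 (s n)).
by move=> i ni; rewrite (sm i.+1 (n - i.+1))// subnKC.
Qed.

(** Projections of Borel rather than of closed sets: the two agree by
    [analytic_closed], and with Borel sets closure under the set operations needed
    below is immediate. *)
Definition analytic (A : set baire) :=
  exists B, borelN B /\ forall x, A x <-> exists u, B (join x u).

Lemma analytic_ext A B : (forall x, A x <-> B x) -> analytic A -> analytic B.
Proof. by move=> AB; have -> : A = B by apply/predeqP. Qed.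

Definition joinE := (evens_join, odds_join).

Lemma borel_fun_evens_id : borel_fun borelN evens. Proof. exact: borel_fun_evens borel_fun_id. Qed.
Lemma borel_fun_odds_id : borel_fun borelN odds. Proof. exact: borel_fun_odds borel_fun_id. Qed.

Ltac borel_fun_tac := repeat first [exact: borel_fun_id | exact: borel_fun_evens_id |
  exact: borel_fun_odds_id | apply: borel_fun_evens |
  apply: borel_fun_odds | apply: borel_fun_join | apply: (borel_fun_comp borelN_sa); [|by []]].

Lemma analytic_borel A : borelN A -> analytic A.
Proof.
move=> bA; exists (fun z => A (evens z)); split.
  by apply: (borel_fun_preimage borelN_sa _ bA); borel_fun_tac.
by move=> x; split=> [Ax|[u]]; rewrite ?joinE//; exists x; rewrite joinE.
Qed.

Lemma analytic_preimage f A : borel_fun borelN f -> analytic A -> analytic (fun x => A (f x)).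
Proof.
move=> bf [B [bB AB]]; exists (fun z => B (join (f (evens z)) (odds z))); split.
  by apply: (borel_fun_preimage borelN_sa _ bB); borel_fun_tac.
by move=> x; rewrite AB; split=> -[u] H; exists u; move: H; rewrite !joinE.
Qed.

Lemma analytic_and A B : analytic A -> analytic B -> analytic (fun x => A x /\ B x).
Proof.
move=> [A' [bA hA]] [B' [bB hB]].
exists (fun z => A' (join (evens z) (evens (odds z))) /\
  B' (join (evens z) (odds (odds z)))); split.
  apply: (sa_and borelN_sa).
    by apply: (borel_fun_preimage borelN_sa _ bA); borel_fun_tac.
  by apply: (borel_fun_preimage borelN_sa _ bB); borel_fun_tac.
move=> x; rewrite hA hB; split=> [[[u Au] [v Bv]]|[u]].
  by exists (join u v); rewrite !joinE.
by rewrite !joinE => -[? ?]; split; [exists (evens u)|exists (odds u)].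
Qed.

Lemma analytic_ex A : analytic A -> analytic (fun x => exists y, A (join x y)).
Proof.
move=> [A' [bA hA]].
exists (fun z => A' (join (join (evens z) (evens (odds z))) (odds (odds z)))); split.
  by apply: (borel_fun_preimage borelN_sa _ bA); borel_fun_tac.
move=> x; split=> [[y /hA[u Au]]|[u]].
  by exists (join y u); rewrite !joinE.
by rewrite !joinE => Au; exists (evens u); apply/hA; exists (odds u).
Qed.

Lemma closed2_regroup C : closed2 C ->
  closed2 (fun x v => C (join x (evens v)) (odds v)).
Proof.
move=> cC x u H; apply: cC => n; case: (H n.*2) => x' [u' [ax au Cu]].
exists (join x' (evens u')), (odds u'); split=> //; last exact: agree_odds.
apply: agree_join; last exact: agree_evens.
by apply: agree_le ax; rewrite -addnn leq_addr.
Qed.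

Lemma analytic_closed A : analytic A ->
  exists C, closed2 C /\ forall x, A x <-> exists v, C x v.
Proof.
move=> [B [/borel_closed_graph[C [w [cC _ Cw]]] AB]].
exists (fun x v => C (join x (evens v)) (odds v)); split.
  exact: closed2_regroup.
move=> x; rewrite AB; split=> [[u Bu]|[v Cv]].
  by exists (join u (w (join x u))); rewrite !joinE; apply/Cw.
by exists (evens v); case/Cw: Cv.
Qed.

(** If no Borel set separates, then among the countably many pairs of pieces
    obtained by prescribing one more term of the point and of both witnesses, some
    pair is not separated either.  The limit of such pieces is a common point. *)
Lemma analytic_separation A A' : analytic A -> analytic A' -> (forall x, A x -> A' x -> False) ->
  exists D, [/\ borelN D, forall x, A x -> D x & forall x, A' x -> D x -> False].
Proof.
move=> /analytic_closed[C [cC hA]] /analytic_closed[C' [cC' hA']] AA'.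
pose SA (C : baire -> baire -> Prop) n (x v z : baire) :=
  agree n x z /\ exists u, agree n v u /\ C z u.
(* The components are terms of the point, of its witness for A and of its
   witness for A'. *)
pose sep n (a : nat -> nat * nat * nat) :=
  exists D, [/\ borelN D,
   forall z, SA C n (fun i => (a i).1.1) (fun i => (a i).1.2) z -> D z &
   forall z, SA C' n (fun i => (a i).1.1) (fun i => (a i).2) z -> D z -> False].
apply: contrapT => nsep.
case: (@limit_branch _ (fun n a => ~ sep n a) (fun=> (0, 0, 0))).
- move=> [D [bD h1 h2]]; apply: nsep; exists D; split=> // x.
    by move=> /hA[u Cu]; apply: h1; split=> [i//|]; exists u; split=> // i.
  by move=> /hA'[u Cu]; apply: h2; split=> [i//|]; exists u; split=> // i.
- move=> n a na; apply: contrapT => H.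
  pose ext m i := if i == n then m else a i : nat * nat * nat.
  have sepe m : sep n.+1 (ext m).
    apply: contrapT => ns; apply: H; exists (ext m); split=> // i ni.
    by rewrite /ext; case: eqP ni => // ->; rewrite ltnn.
  pose D m := projT1 (cid (sepe m)).
  have [bD h1 h2] : [/\ forall m, borelN (D m),
    forall m z, SA C n.+1 (fun i => (ext m i).1.1) (fun i => (ext m i).1.2) z -> D m z &
    forall m z, SA C' n.+1 (fun i => (ext m i).1.1) (fun i => (ext m i).2) z ->
      D m z -> False].
    by split=> m; case: (projT2 (cid (sepe m))).
  have extE (f : nat * nat * nat -> nat) m (z : baire) :
      agree n (fun i => f (a i)) z -> f m = z n -> agree n.+1 (fun i => f (ext m i)) z.
    move=> az fm i; rewrite ltnS leq_eqVlt /ext; case: eqP => [->//|_ /=].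
    exact: az.
  apply: na; exists (fun z => exists m, z n = m /\ exists k, forall k', D (m, k, k') z).
  split.
  + apply: (sa_ex borelN_sa) => m; apply: (sa_and borelN_sa); first exact: borel_fun_id.
    by apply: (sa_ex borelN_sa) => k; apply: (sa_all borelN_sa).
  + move=> z [az [u [vu Cu]]]; exists (z n); split=> //; exists (u n) => k'.
    apply: h1; split; first exact: (extE (fun p => p.1.1)).
    by exists u; split=> //; exact: (extE (fun p => p.1.2)).
  + move=> z [az [u [vu Cu]]] [m [zm [k /(_ (u n))]]].
    apply: h2; split; first by apply: (extE (fun p => p.1.1)).
    by exists u; split=> //; exact: (extE (fun p => p.2)).
move=> a Ha.
pose x i := (a i).1.1; pose v i := (a i).1.2; pose v' i := (a i).2.
apply: (AA' x).
  apply/hA; exists v; apply: cC => n; case: (Ha n) => b [ab nb].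
  apply: contrapT => H; apply: nb; exists (fun=> False); split=> //.
    exact: sa_cst borelN_sa _.
  move=> z [az [u [vu Cu]]]; apply: H; exists z, u; split=> // i ni.
    by rewrite /x ab// az.
  by rewrite /v ab// vu.
apply/hA'; exists v'; apply: cC' => n; case: (Ha n) => b [ab nb].
apply: contrapT => H; apply: nb; exists (fun=> True); split=> //.
  exact: sa_cst borelN_sa _.
move=> z [az [u [vu Cu]]] _; apply: H; exists z, u; split=> // i ni.
  by rewrite /x ab// az.
by rewrite /v' ab// vu.
Qed.

(** For each n and m, the set of x whose image has n-th term m and the set of x
    whose image has another n-th term are disjoint analytic sets.  Borel sets
    separating them determine the image one term at a time. *)
Lemma analytic_functional A : analytic A ->
  (forall x y y', A (join x y) -> A (join x y') -> y = y') ->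
  exists2 U, borel_fun borelN U & forall x y, A (join x y) -> y = U x.
Proof.
move=> aA fA.
have sep n m : exists D, [/\ borelN D,
    forall x y, A (join x y) -> y n = m -> D x &
    forall x y, A (join x y) -> y n <> m -> D x -> False].
  have bm : borelN (fun z => odds z n = m) by apply: borel_fun_odds; exact: borel_fun_id.
  have a1 := analytic_ex (analytic_and aA (analytic_borel bm)).
  have a2 := analytic_ex (analytic_and aA (analytic_borel (sa_not borelN_sa bm))).
  case: (analytic_separation a1 a2) => [x [y [Ay ym]] [y' [Ay' ym']]|D [bD h1 h2]].
    by move: ym ym'; rewrite !joinE (fA _ _ _ Ay Ay').
  exists D; split=> // x y Ay ym.
    by apply: h1; exists y; rewrite !joinE.
  by apply: h2; exists y; rewrite !joinE.
pose D n m := projT1 (cid (sep n m)).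
have hD n m : [/\ borelN (D n m),
    forall x y, A (join x y) -> y n = m -> D n m x &
    forall x y, A (join x y) -> y n <> m -> D n m x -> False] := projT2 (cid (sep n m)).
have bD n m : borelN (D n m) by case: (hD n m).
pose G n m x := D n m x /\ forall k, k <> m -> ~ D n k x.
case: (@borel_fun_graph _ borelN G borelN_sa) => [n m|n m m' t [Dm hm] [Dm' hm']|U bU hU].
- apply: (sa_and borelN_sa) => //; apply: (sa_all borelN_sa) => k.
  case: (pselect (k = m)) => km; first by apply: sa_ext (sa_cst borelN_sa True) => x; split.
  by apply: sa_ext (sa_not borelN_sa (bD n k)) => x; split=> //; apply.
- by apply: contrapT => mm'; apply: (hm m') => // /esym.
exists U => // x y Ay; apply/funext => n; apply/esym/hU; split.
  by case: (hD n (y n)) => _ + _; apply; [exact: Ay|].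
move=> k ky; case: (hD n k) => _ _ /(_ x y Ay); apply.
by move/esym.
Qed.

(** * The Lusin-Novikov theorem *)

Definition prefix_of (s : seq nat) (v : baire) := forall i, (i < size s)%N -> nth 0 s i = v i.

Definition node_le (s t : seq nat) := (size s <= size t)%N /\ prefix_of s (nth 0 t).

Lemma prefix_of_mkseq v n : prefix_of (mkseq v n) v.
Proof. by move=> i; rewrite size_mkseq => ni; rewrite nth_mkseq. Qed.

Lemma node_le_mkseq s v n : prefix_of s v -> (size s <= n)%N -> node_le s (mkseq v n).
Proof.
move=> sv sn; split; rewrite ?size_mkseq// => i si.
by rewrite nth_mkseq ?sv// (leq_trans si).
Qed.

Lemma borel_prefix_of s : borelN (prefix_of s).
Proof.
apply: (sa_all borelN_sa) => i; case: (pselect (i < size s)%N) => si.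
  apply: (sa_ext _ (borel_fun_id i (nth 0 s i))) => x; split=> [->//|H].
  exact/esym/H.
by apply: (sa_ext _ (sa_cst borelN_sa True)) => x; split.
Qed.

Lemma prefix_of_limit (s : nat -> seq nat) :
  (forall n, node_le (s n) (s n.+1)) -> (forall n, (n <= size (s n))%N) ->
  exists v, forall n, prefix_of (s n) v.
Proof.
move=> sS szs.
have sk n k : node_le (s n) (s (n + k)).
  elim: k => [|k [IH1 IH2]]; first by rewrite addn0; split.
  rewrite addnS; case: (sS (n + k)) => h1 h2.
  split=> [|i si]; first exact: leq_trans h1.
  by rewrite IH2// h2// (leq_trans si).
exists (fun i => nth 0 (s i.+1) i) => n i si.
case: (leqP n i.+1) => ni.
  by case: (sk n (i.+1 - n)) => _; rewrite subnKC//; apply.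
case: (sk i.+1 (n - i.+1)) => _; rewrite subnKC ?(ltnW ni)// => /(_ i) -> //.
Qed.

Lemma indexed_choice (T : Type) (Q : nat -> T -> Prop) (R : nat -> T -> T -> Prop) a0 :
  Q 0 a0 -> (forall n a, Q n a -> exists b, Q n.+1 b /\ R n a b) ->
  exists a : nat -> T, [/\ a 0 = a0, forall n, Q n (a n) & forall n, R n (a n) (a n.+1)].
Proof.
move=> Q0 step.
have nxt n (a : {a | Q n a}) : {b : {b | Q n.+1 b} | R n (projT1 a) (projT1 b)}.
  case: a => a Qa; apply: cid; case: (step n a Qa) => b [Qb ab].
  by exists (exist _ b Qb).
pose s : forall n, {a | Q n a} := fix s n :=
  if n is n'.+1 then projT1 (nxt n' (s n')) else exist _ a0 Q0.
exists (fun n => projT1 (s n)); split=> [//|n|n]; first exact: (projT2 (s n)).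
exact: (projT2 (nxt n (s n))).
Qed.

Section LusinNovikov.
Variables (C : baire -> baire -> Prop).
Hypothesis bC : borelN (fun z => C (evens z) (odds z)).

Definition config := (seq nat * seq (seq nat))%type.

(** Below, taking even terms maps the sections of C onto the sections of the set
    to be covered; here the graphs of the functions U k have been removed. *)
Definition fiber (U : nat -> baire -> baire) x v := C x v /\ forall k, evens v <> U k x.

(** The first component of a configuration is an initial segment of x; the second
    is a finite set of nodes, which describe several points over the same x. *)
Definition live U (a : config) x :=
  prefix_of a.1 x /\ forall s, s \in a.2 -> exists v, prefix_of s v /\ fiber U x v.

Definition absorbable (a : config) := exists U,
  (forall k, borel_fun borelN (U k)) /\ forall x, ~ live U a x.

(** Removing more graphs only makes fewer configurations live, and there are
    countably many configurations, so the families that absorb them can be merged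
    into one. *)
Lemma exists_saturated : exists U, (forall k, borel_fun borelN (U k)) /\
  forall a, absorbable a -> forall x, ~ live U a x.
Proof.
have H a : exists V, (forall k, borel_fun borelN (V k)) /\ (absorbable a -> forall x, ~ live V a x).
  case: (pselect (absorbable a)) => [[V [bV lV]]|ns]; first by exists V.
  by exists (fun _ _ => fun=> 0); split=> // k; exact: borel_fun_cst borelN_sa _.
pose V a := projT1 (cid (H a)).
have hV a : (forall k, borel_fun borelN (V a k)) /\ (absorbable a -> forall x, ~ live (V a) a x) :=
  projT2 (cid (H a)).
(* Indices that code no configuration get the constant function 0; removing
   one more graph is harmless. *)
exists (fun n => if unpickle (Cantor.of_nat n).1 is Some a then V a (Cantor.of_nat n).2
                 else fun=> fun=> 0); split.
  move=> k; case: unpickle => [a|]; first by case: (hV a).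
  exact: borel_fun_cst borelN_sa _.
move=> a /(proj2 (hV a)) la x [ax lx]; apply: (la x); split=> // s sa.
case: (lx s sa) => v [sv [Cv nv]]; exists v; split=> //; split=> // k.
by have := nv (Cantor.to_nat (pickle a, k)); rewrite Cantor.cancel_of_to/= pickleK.
Qed.

Variable U : nat -> baire -> baire.
Hypothesis bU : forall k, borel_fun borelN (U k).
Hypothesis satU : forall a, absorbable a -> forall x, ~ live U a x.

Lemma borel_fiber : borelN (fun z => fiber U (evens z) (odds z)).
Proof.
apply: (sa_and borelN_sa) => //; apply: (sa_all borelN_sa) => k; apply: (sa_not borelN_sa).
apply: (borel_fun_eq borelN_sa); first by borel_fun_tac.
by apply: (borel_fun_comp borelN_sa); first by borel_fun_tac.
Qed.

Lemma analytic_node s : analytic (fun x => exists v, prefix_of s v /\ fiber U x v).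
Proof.
have bS : borelN (fun z => prefix_of s (odds z) /\ fiber U (evens z) (odds z)).
  apply: (sa_and borelN_sa); last exact: borel_fiber.
  by apply: (borel_fun_preimage borelN_sa _ (borel_prefix_of s)); borel_fun_tac.
by apply: (analytic_ext _ (analytic_ex (analytic_borel bS))) => x; split=> -[v H]; exists v;
  move: H; rewrite !joinE.
Qed.

Lemma analytic_live a : analytic (live U a).
Proof.
case: a => p c; apply: analytic_and; first exact: (analytic_borel (borel_prefix_of p)).
elim: c => [|s c IH] /=.
  by apply: (analytic_ext _ (analytic_borel (sa_cst borelN_sa True))) => x; split.
apply: (analytic_ext _ (analytic_and (analytic_node s) IH)) => x; split.
  by move=> [h1 h2] t; rewrite inE => /orP[/eqP->|/h2].
move=> H; split; first by apply: H; rewrite inE eqxx.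
by move=> t tc; apply: H; rewrite inE tc orbT.
Qed.

(** If all points of the fibers above the node s had the same even terms, over
    every x at which a is live, these pairs would form an analytic partial
    function.  Adding a Borel function that contains it to U would absorb a,
    against the choice of U. *)
Lemma live_split a x0 s : live U a x0 -> s \in a.2 -> exists x v v',
  [/\ live U a x, prefix_of s v /\ fiber U x v, prefix_of s v' /\ fiber U x v' &
      evens v <> evens v'].
Proof.
move=> ax0 sa; apply: contrapT => H.
pose B z := prefix_of s (odds z) /\ fiber U (evens (evens z)) (odds z) /\
  evens (odds z) = odds (evens z).
have bB : borelN B.
  apply: (sa_and borelN_sa).
    by apply: (borel_fun_preimage borelN_sa _ (borel_prefix_of s)); borel_fun_tac.
  apply: (sa_and borelN_sa); last by apply: (borel_fun_eq borelN_sa); borel_fun_tac.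
  have := borel_fun_preimage borelN_sa
    (f := fun z => join (evens (evens z)) (odds z)) ltac:(by borel_fun_tac) borel_fiber.
  by apply: sa_ext => z; rewrite !joinE.
pose A z := live U a (evens z) /\ exists v, B (join z v).
have aA : analytic A.
  apply: analytic_and; first by apply: (analytic_preimage _ (analytic_live a)); borel_fun_tac.
  exact: (analytic_ex (analytic_borel bB)).
have AE x y : A (join x y) -> live U a x /\ exists v, (prefix_of s v /\ fiber U x v) /\ evens v = y.
  by rewrite /A /B !joinE => -[? [v]]; rewrite !joinE => -[? [? ?]]; split=> //; exists v.
case: (analytic_functional aA) => [x y y' /AE[lx [v [vf <-]]] /AE[_ [v' [vf' <-]]]|V bV hV].
  by apply: contrapT => vv'; apply: H; exists x, v, v'.
apply: (satU (a := a)) ax0.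
(* The new function V takes index 0 and shifts the family U. *)
exists (fun k => if k is k'.+1 then U k' else V); split=> [[|k]//|x [ax lx]].
have lUx : live U a x.
  split=> // t /lx[v [tv [Cv nv]]]; exists v; split=> //; split=> // k.
  exact: (nv k.+1).
case: (lx s sa) => v [sv [Cv nv]]; apply: (nv 0); apply: hV.
rewrite /A /B !joinE; split=> //; exists v; rewrite !joinE; split=> //; split=> //; split=> // k.
exact: (nv k.+1).
Qed.

(** Even terms are compared because they code the point of the section, the odd
    ones being part of the witness. *)
Definition escapes (s t : seq nat) (y : baire) :=
  [/\ node_le s t, (size s < size t)%N & exists2 n, (n.*2 < size t)%N & nth 0 t n.*2 <> y n].

(** The two refinements have incompatible even terms, so that any given y is
    avoided by at least one of them.  The old nodes are kept. *)
Lemma live_split1 p (c : seq (seq nat)) x0 s : live U (p, c) x0 -> s \in c -> exists s0 s1,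
  (exists x, live U (p, [:: s0, s1 & c]) x) /\
  forall y, escapes s s0 y \/ escapes s s1 y.
Proof.
move=> l0 sc; have [x [v [v' [[px lx] [sv fv] [sv' fv'] vv']]]] := live_split l0 sc.
have [n nn] : exists n, v n.*2 <> v' n.*2.
  apply: contrapT => H; apply: vv'; apply/funext => n; apply: contrapT => nn.
  by apply: H; exists n.
pose l := (maxn (size s).+1 n.*2.+1).
have sl : (size s < l)%N by rewrite leq_max leqnn.
have nl : (n.*2 < l)%N by rewrite leq_max leqnn orbT.
exists (mkseq v l), (mkseq v' l); split.
  exists x; split=> //= t; rewrite !inE => /or3P[/eqP->|/eqP->|/lx//].
    by exists v; split=> //; exact: prefix_of_mkseq.
  by exists v'; split=> //; exact: prefix_of_mkseq.
have esc w y : prefix_of s w -> w n.*2 <> y n -> escapes s (mkseq w l) y.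
  move=> sw wy; split; first by apply: node_le_mkseq => //; exact: ltnW.
    by rewrite size_mkseq.
  by exists n; rewrite ?size_mkseq ?nth_mkseq.
move=> y; case: (pselect (v n.*2 = y n)) => vy; [right|left]; apply: esc => //.
by rewrite -vy => /esym.
Qed.

Lemma live_split_all p (c todo : seq (seq nat)) x0 : live U (p, c) x0 -> {subset todo <= c} ->
  exists c', [/\ {subset c <= c'}, exists x, live U (p, c') x &
    forall s, s \in todo -> forall y, exists2 t, t \in c' & escapes s t y].
Proof.
move=> l0; elim: todo => [|s todo IH] sub.
  by exists c; split=> //; exists x0.
have [|c1 [cc1 [x lx] h1]] := IH.
  by move=> t ts; apply: sub; rewrite inE ts orbT.
have [|s0 [s1 [lx' h2]]] := live_split1 lx (s := s).
  by apply/cc1/sub; rewrite inE eqxx.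
exists [:: s0, s1 & c1]; split=> //.
  by move=> t /cc1 tc; rewrite !inE tc !orbT.
move=> t; rewrite inE => /orP[/eqP->|tt] y.
  by case: (h2 y) => h; [exists s0|exists s1] => //; rewrite !inE eqxx ?orbT.
by case: (h1 t tt y) => u uc e; exists u => //; rewrite !inE uc !orbT.
Qed.

Hypothesis cC : closed2 C.
Hypothesis ctC : forall x, countable [set evens v | v in C x].

(** From a point that is not covered, build an increasing sequence of live
    configurations in which every node is split at the next stage, with initial
    segments of x converging to a point z.  Along these nodes choose a branch whose
    k-th step avoids the k-th element of the section at z.  By closedness the limit
    of the branch is in that section, which is absurd. *)
Lemma saturated_covers x v : C x v -> exists k, evens v = U k x.
Proof.
move=> Cxv; apply: contrapT => H.
pose Q (n : nat) (a : config) := exists x, live U a x.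
pose R (n : nat) (a b : config) := [/\ node_le a.1 b.1, size b.1 = (size a.1).+1 &
  forall s, s \in a.2 -> forall y, exists2 t, t \in b.2 & escapes s t y].
have Q0 : Q 0 ([::], [:: [::]]).
  exists x; split=> // s; rewrite inE => /eqP ->; exists v; split=> //; split=> // k vk.
  by apply: H; exists k.
have [n [p c] [x1 l1]|a [a0 Qa Ra]] := @indexed_choice _ Q R _ Q0.
  have [//|c' [_ [x2 [px2 l2]] h2]] := live_split_all l1 (todo := c).
  exists (mkseq x2 (size p).+1, c'); split.
    by exists x2; split=> //; exact: prefix_of_mkseq.
  by split=> //; [exact: node_le_mkseq|exact: size_mkseq].
have sza n : size (a n).1 = n.
  by elim: n => [|n IH]; [rewrite a0|case: (Ra n) => _ -> _; rewrite IH].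
case: (@prefix_of_limit (fun n => (a n).1)) => [n|n|z az].
- by case: (Ra n).
- by rewrite sza.
case/countable_injP: (ctC z) => num injnum.
(* The value 0 at indices that number no element of the section only adds a
   point to avoid. *)
pose y k := if pselect (exists v, C z v /\ num (evens v) = k) is left e
  then evens (projT1 (cid e)) else fun=> 0.
have [||s [s0 sQ sR]] := @indexed_choice _
  (fun n s => s \in (a n).2 /\ (n <= size s)%N) (fun k s t => escapes s t (y k)) [::].
- by rewrite a0 inE.
- move=> n s [sa ns]; case: (Ra n) => _ _ /(_ s sa (y n)) [t ta e].
  by exists t; split=> //; split=> //; case: e => _ /(leq_ltn_trans ns).
case: (@prefix_of_limit s) => [n|n|w sw].
- by case: (sR n).
- by case: (sQ n).
have Cw : C z w.
  apply: cC => n; case: (Qa n) => x' [ax' lx'].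
  case: (lx' _ (proj1 (sQ n))) => v' [sv' [Cv' _]].
  exists x', v'; split=> // i ni.
    by rewrite -(az n) ?sza// ax' ?sza.
  have si : (i < size (s n))%N by apply: leq_trans (proj2 (sQ n)).
  by rewrite -(sw n)// sv'.
pose k := num (evens w).
have yk : y k = evens w.
  rewrite /y; case: pselect => [e|[]]; last by exists w.
  case: (cid e) => v' [Cv' nk] /=; apply: injnum nk; rewrite in_setE.
    by exists v'.
  by exists w.
case: (sR k) => _ _ [n nk]; apply; rewrite sw// yk.
by [].
Qed.

End LusinNovikov.

(** Saturation is applied to the closed relation that carries both the second
    coordinate, as even terms, and the witness of membership in P, as odd terms. *)
Theorem lusin_novikov (P : set baire) : borelN P ->
  (forall x, countable [set y | P (join x y)]) ->
  exists U : nat -> baire -> baire, (forall k, borel_fun borelN (U k)) /\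
    forall x y, P (join x y) -> exists k, y = U k x.
Proof.
move=> bP ctP; have [C [w [cC bw Cw]]] := borel_closed_graph bP.
pose D x v := C (join x (evens v)) (odds v).
have DP x v : D x v <-> P (join x (evens v)) /\ odds v = w (join x (evens v)) by exact: Cw.
have bD : borelN (fun z => D (evens z) (odds z)).
  have := sa_and borelN_sa
    (borel_fun_preimage borelN_sa
      (f := fun z => join (evens z) (evens (odds z))) ltac:(by borel_fun_tac) bP)
    (borel_fun_eq borelN_sa
      (f := fun z => odds (odds z)) (g := fun z => w (join (evens z) (evens (odds z))))
      ltac:(by borel_fun_tac) ltac:(by borel_fun_tac)).
  by apply: sa_ext => z; rewrite DP.
have ctD x : countable [set evens v | v in D x].
  apply: sub_countable (ctP x); apply: subset_card_le => y /= [v /DP[Pv _] <-].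
  exact: Pv.
have [U [bU satU]] := exists_saturated D.
exists U; split=> // x y Pxy.
have := saturated_covers bD bU satU (closed2_regroup cC) ctD.
move=> /(_ x (join y (w (join x y)))); rewrite !joinE; apply.
by apply/DP; rewrite !joinE.
Qed.

(** * Polish spaces as Borel subsets of the Baire space *)

Local Open Scope ring_scope.

Definition preimage_system (T U : Type) (f : T -> U) (G : set (set U)) : set (set T) :=
  [set f @^-1` B | B in G].

Lemma preimage_system_sa (T U : Type) (f : T -> U) (G : set (set U)) :
  sigma_algebra setT G -> sigma_algebra setT (preimage_system f G).
Proof.
move=> [G0 GC GU]; split.
- by exists set0 => //; rewrite preimage_set0.
- by move=> _ [B GB <-]; exists (setT `\` B); [exact: GC|].
- move=> A GA; pose B n := projT1 (cid2 (GA n)).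
  exists (\bigcup_n B n).
    by apply: GU => n; rewrite /B; case: cid2.
  rewrite preimage_bigcup; apply: eq_bigcupr => n _; rewrite /B.
  by case: cid2.
Qed.

(** The standard Borel structures, presented as Borel subsets of the Baire
    space. *)
Definition coded (T : Type) (S : set (set T)) := exists phi : T -> baire,
  [/\ injective phi, borelN (range phi) & S = preimage_system phi borelN].

Lemma coded_sa T (S : set (set T)) : coded S -> sigma_algebra setT S.
Proof. by move=> [phi [_ _ ->]]; apply: preimage_system_sa; exact: borelN_sa. Qed.

Lemma borel_fun_preimage_system T (phi : T -> baire) : borel_fun (preimage_system phi borelN) phi.
Proof.
move=> n m; exists [set x : baire | x n = m] => //; exact: borel_fun_id.
Qed.

Lemma preimage_system_sub T (S : set (set T)) (phi : T -> baire) :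
  sigma_algebra setT S -> borel_fun S phi -> preimage_system phi borelN `<=` S.
Proof. by move=> hS bp _ [B bB <-]; exact: (borel_fun_preimage hS bp bB). Qed.

Lemma open_mdist_lt (R : realType) (M : metricType R) (y : M) (e : R) :
  open [set x | mdist x y < e].
Proof.
rewrite openE => x /= xy; apply/nbhs_ballP.
exists (e - mdist x y); first by rewrite /= subr_gt0.
move=> z; rewrite ballEmdist /= => xz.
rewrite (le_lt_trans (metric_triangle _ x _))// metric_sym.
by rewrite -ltrBrDr.
Qed.

Section PolishCoded.
Variables (R : realType) (M : metricType R) (d : nat -> M).
Hypothesis hd : forall x (e : R), 0 < e -> exists k, mdist x (d k) < e.
Hypothesis cM : forall F : set_system M, ProperFilter F -> cauchy F ->
  exists l : M, F --> l.

Let r n : R := n.+1%:R^-1.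

Let r_gt0 n : 0 < r n. Proof. by rewrite invr_gt0 ltr0n. Qed.

Let r_small (e : R) : 0 < e -> exists n, r n < e.
Proof. by move=> /ltr_add_invr[k]; rewrite add0r; exists k. Qed.

Let r_mono m n : (m <= n)%N -> r n <= r m.
Proof. by move=> mn; rewrite lef_pV2 ?posrE ?ltr0n// ler_nat ltnS. Qed.

(** The n-th term is the index of the first point of the dense sequence within
    distance 1/(n+1); unlike a nearest point, it always exists. *)
Definition near_code x n := ex_minn (hd x (r_gt0 n)).

Let near_codeP x n m : near_code x n = m <->
  mdist x (d m) < r n /\ forall k, (k < m)%N -> ~ mdist x (d k) < r n.
Proof.
rewrite /near_code; case: ex_minnP => k hk mk; split=> [<-|[hm mm]].
  by split=> // j jk /mk; rewrite leqNgt jk.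
apply/eqP; rewrite eqn_leq mk//= leqNgt; apply/negP => /mm; exact.
Qed.

Let near_code_lt x n : mdist x (d (near_code x n)) < r n.
Proof. by case: (near_codeP x n (near_code x n)) => -[]. Qed.

Let BM : set (set M) := <<s @open M >>.
Let BMs : sigma_algebra setT BM. Proof. exact: smallest_sigma_algebra. Qed.

Let ball_meas y e : BM [set x | mdist x y < e].
Proof. by apply: sub_sigma_algebra; exact: open_mdist_lt. Qed.

Let borel_fun_near_code : borel_fun BM near_code.
Proof.
move=> n m.
have := sa_and BMs (ball_meas (d m) (r n))
  (sa_all BMs (fun k => sa_or BMs (sa_cst BMs (~ (k < m)%N))
    (sa_not BMs (ball_meas (d k) (r n))))).
apply: sa_ext => x; rewrite near_codeP; split=> -[h1 h2]; split=> // k.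
  by case: (h2 k).
by case: (pselect (k < m)%N) => km; [right; exact: h2|left].
Qed.

(** An open set is the union of the sets where some term of the code certifies
    that a whole ball is included. *)
Let open_code (O : set M) : open O -> preimage_system near_code borelN O.
Proof.
move=> oO.
pose I n k := [set x | mdist x (d k) < r n] `<=` O.
exists (fun u : baire => exists n k, u n = k /\ I n k).
  apply: (sa_ex borelN_sa) => n; apply: (sa_ex borelN_sa) => k.
  by apply: (sa_and borelN_sa); [exact: borel_fun_id|exact: sa_cst borelN_sa _].
apply/predeqP => x; split=> [[n [k [<-]]]|Ox]; first by apply; exact: near_code_lt.
move: oO; rewrite openE => /(_ x Ox) /nbhs_ballP[e /= e0 eO].
have [n rn] := r_small (divr_gt0 e0 (ltr0n R 2)).
exists n, (near_code x n); split=> // y /= yd; apply: eO; rewrite ballEmdist/=.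
rewrite (le_lt_trans (metric_triangle _ (d (near_code x n)) _))//.
by rewrite (splitr e) ltrD ?(lt_trans (near_code_lt x n))// metric_sym (lt_trans yd).
Qed.

Let near_code_inj : injective near_code.
Proof.
move=> x y xy; apply: mdist_positivity; apply/eqP; rewrite eq_le mdist_ge0 andbT.
apply/ler_addgt0Pl => /= e e0; rewrite addr0.
have [n rn] := r_small (divr_gt0 e0 (ltr0n R 2)).
rewrite (le_trans (metric_triangle _ (d (near_code x n)) _))//.
rewrite (splitr e) lerD// ltW// ?(lt_trans (near_code_lt x n))//.
by rewrite metric_sym xy (lt_trans (near_code_lt y n)).
Qed.

(** Together, A and L express that u is a code without mentioning the point:
    A makes the approximations a Cauchy sequence, and L u j n expresses that the
    limit lies within 1/(n+1) of d j. *)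
Let A (u : baire) := forall n m, mdist (d (u n)) (d (u m)) < r n + r m.
Let L (u : baire) j n := exists m, mdist (d (u m)) (d j) + r m < r n.

Let LE u x j n : (forall m, mdist x (d (u m)) <= r m) ->
  L u j n <-> mdist x (d j) < r n.
Proof.
move=> xu; split=> [[m h]|h].
  rewrite (le_lt_trans _ h)// (le_trans (metric_triangle _ (d (u m)) _))//.
  by rewrite addrC lerD.
have e0 : 0 < r n - mdist x (d j) by rewrite subr_gt0.
have [m rm] := r_small (divr_gt0 e0 (ltr0n R 2)); exists m.
rewrite (@le_lt_trans _ _ (mdist x (d j) + r m + r m))//.
  rewrite lerD2r (le_trans (metric_triangle _ x _))// addrC lerD2l metric_sym.
  exact: xu.
by rewrite -addrA addrC -ltrBrDr (splitr (r n - _)) ltrD.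
Qed.

Let lim_exists u : A u -> exists x, forall m, mdist x (d (u m)) <= r m.
Proof.
move=> Au.
have [|l ul] := cM (F := (fun n => d (u n)) @ \oo) _.
  apply/cauchy_ballP => e e0; near_simpl.
  have [N rN] := r_small (divr_gt0 e0 (ltr0n R 2)).
  exists ([set n | N <= n]%N, [set n | N <= n]%N) => /=.
    by split; exists N.
  move=> [n m] /= [Nn Nm]; rewrite ballEmdist/= (lt_trans (Au n m))//.
  by rewrite (splitr e) ltrD// (le_lt_trans _ rN)// r_mono.
exists l => m; apply/ler_addgt0Pl => /= e e0.
have [N rN] := r_small (divr_gt0 e0 (ltr0n R 2)).
move/fcvg_ballP : ul => /(_ (e / 2) (divr_gt0 e0 (ltr0n R 2))) [K _ HK].
have := HK (maxn K N) (leq_maxl _ _); rewrite ballEmdist /= => h.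
rewrite (le_trans (metric_triangle _ (d (u (maxn K N))) _))//.
rewrite (splitr e) -addrA lerD// ?ltW// (lt_le_trans (Au _ _))// lerD2r.
by rewrite (le_trans _ (ltW rN))// r_mono// leq_maxr.
Unshelve. all: by end_near.
Qed.

Let borel_L j n : borelN (fun u => L u j n).
Proof.
apply: (sa_ex borelN_sa) => m.
have := sa_ex borelN_sa (fun k => sa_and borelN_sa (borel_fun_id m k)
  (sa_cst borelN_sa (mdist (d k) (d j) + r m < r n))).
apply: sa_ext => u; split=> [[k [<-]]//|h]; by exists (u m).
Qed.

Let borel_range : borelN (range near_code).
Proof.
have bA : borelN A.
  apply: (sa_all borelN_sa) => n; apply: (sa_all borelN_sa) => m.
  have := sa_ex borelN_sa (fun k => sa_ex borelN_sa (fun l => sa_and borelN_sa (borel_fun_id n k)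
    (sa_and borelN_sa (borel_fun_id m l) (sa_cst borelN_sa (mdist (d k) (d l) < r n + r m))))).
  apply: sa_ext => u; split=> [[k [l [<- [<-]]]]//|h]; by exists (u n), (u m).
have bL n : borelN (fun u => L u (u n) n /\ forall j, (j < u n)%N -> ~ L u j n).
  have := sa_ex borelN_sa (fun k => sa_and borelN_sa (borel_fun_id n k)
    (sa_and borelN_sa (borel_L k n) (sa_all borelN_sa (fun j =>
      sa_or borelN_sa (sa_cst borelN_sa (~ (j < k)%N)) (sa_not borelN_sa (borel_L j n)))))).
  apply: sa_ext => u; split=> [[k [<- [h1 h2]]]|[h1 h2]].
    by split=> // j; case: (h2 j).
  exists (u n); split=> //; split=> // j.
  by case: (pselect (j < u n)%N) => ju; [right; exact: h2|left].
have := sa_and borelN_sa bA (sa_all borelN_sa bL); apply: sa_ext => u; split.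
  move=> [/lim_exists[x xu] Lu]; exists x => //; apply/funext => n.
  apply/near_codeP; case: (Lu n) => /(LE _ _ xu) h1 h2; split=> // k ku.
  by move/(LE _ _ xu); exact: h2.
move=> [x _ <-]; have xu m : mdist x (d (near_code x m)) <= r m by apply/ltW.
split=> [n m|n].
  rewrite (le_lt_trans (metric_triangle _ x _))// ltrD ?near_code_lt//.
  by rewrite metric_sym near_code_lt.
split; first by apply/(LE _ _ xu); exact: near_code_lt.
move=> j ju /(LE _ _ xu); case: (near_codeP x n (near_code x n)) => /(_ erefl)[_ h] _.
exact: h.
Qed.

Lemma polish_coded : coded BM.
Proof.
exists near_code; split=> //; apply/seteqP; split.
  apply: smallest_sub; last by move=> O; exact: open_code.
  by apply: preimage_system_sa; exact: borelN_sa.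
exact: preimage_system_sub.
Qed.

End PolishCoded.

Lemma coded_bij (T U : Type) (f : T -> U) (S : set (set U)) :
  bijective f -> coded S -> coded (preimage_system f S).
Proof.
move=> [g fK gK] [phi [ip bp ->]]; exists (phi \o f); split.
- by apply: inj_comp => //; exact: can_inj fK.
- move: bp; apply: sa_ext => x; split=> [[u _ <-]|[t _ <-]].
    by exists (g u) => //=; rewrite gK.
  by exists (f t).
- apply/seteqP; split=> [_ [_ [B bB <-] <-]|_ [B bB <-]]; first by exists B.
  by exists (phi @^-1` B) => //; exists B.
Qed.

Lemma standard_coded (R : realType) (X : standardBorelType R) : coded (borel X).
Proof.
have [M [f [[[D cD dD] cM] bf ->]]] := borel_polish X.
apply: coded_bij => //.
(* A dense sequence needs a point, so the empty space is set apart. *)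
case: (pselect (exists x : M, True)) => [[x0 _]|nM]; last first.
  have nT (x : M) : False by apply: nM; exists x.
  exists (fun x => fun=> 0%N); split.
  - by move=> x; case: (nT x).
  - by apply: (sa_ext _ (sa_cst borelN_sa False)) => x; split=> // -[y]; case: (nT y).
  - have E (A B : set M) : A = B by apply/predeqP => x; case: (nT x).
    apply/seteqP; split=> A _.
      by exists set0; [exact: (sa_cst borelN_sa False)|exact: E].
    by rewrite (E A set0); exact: sigma_algebra0.
have [y0 [_ Dy0]] := dD setT (ex_intro _ x0 I) openT.
case/countable_injP: cD => num inum.
pose d k := if pselect (exists y, D y /\ num y = k) is left e then projT1 (cid e) else y0.
have dE y : D y -> d (num y) = y.
  move=> Dy; rewrite /d; case: pselect => [e|[]]; last by exists y.
  by case: (cid e) => z [Dz nz] /=; apply: inum; rewrite ?in_setE.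
apply: (polish_coded (d := d)) => // x e e0.
have [|y [yx Dy]] := dD _ _ (@open_mdist_lt _ _ x e).
  by exists x => /=; rewrite mdistxx.
by exists (num y); rewrite dE// metric_sym.
Qed.

(** * Borel subsets of the Baire space as Polish spaces *)

Section BranchMetric.
Variables (R : realType) (T : Type) (theta : T -> baire).
Hypothesis theta_inj : injective theta.

(** [None] when the two branches are equal. *)
Definition first_diff (x y : T) : option nat :=
  if pselect (exists i, theta x i != theta y i) is left e
  then Some (ex_minn e) else None.

Lemma first_diffP x y n : agree n (theta x) (theta y) <->
  if first_diff x y is Some k then (n <= k)%N else True.
Proof.
rewrite /first_diff; case: pselect => [e|ne]; last first.
  by split=> // _ i _; apply: contrapT => /eqP h; apply: ne; exists i.
case: ex_minnP => k xk mk; split=> [a|nk i ni].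
  by rewrite leqNgt; apply/negP => /a; apply/eqP.
apply/eqP; apply: contraT => /mk ki; have := leq_trans ni (leq_trans nk ki).
by rewrite ltnn.
Qed.

Definition branch_dist (x y : T) : R :=
  if first_diff x y is Some k then k.+1%:R^-1 else 0.

(** Thresholds of the form 1/(n+1) recover agreement on n terms; all metric
    arguments below go through this equivalence. *)
Lemma branch_dist_le x y n : (branch_dist x y <= n.+1%:R^-1) <-> agree n (theta x) (theta y).
Proof.
rewrite first_diffP /branch_dist; case: first_diff => [k|].
  by rewrite lef_pV2 ?posrE ?ltr0n// ler_nat ltnS.
by rewrite invr_ge0 ler0n.
Qed.

Lemma branch_dist_cases x y :
  (branch_dist x y = 0 /\ x = y) \/ exists n, branch_dist x y = n.+1%:R^-1.
Proof.
case E : (first_diff x y) => [k|]; rewrite /branch_dist E; first by right; exists k.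
left; split=> //; apply: theta_inj; apply: agree_all => n.
by apply/first_diffP; rewrite E.
Qed.

Lemma branch_dist_ge0 x y : 0 <= branch_dist x y.
Proof.
by case: (branch_dist_cases x y) => [[->]|[n ->]]//; rewrite invr_ge0 ler0n.
Qed.

Lemma branch_distxx x : branch_dist x x = 0.
Proof.
case: (branch_dist_cases x x) => [[->]|[n e]]//.
suff /branch_dist_le : agree n.+1 (theta x) (theta x).
  by rewrite e lef_pV2 ?posrE ?ltr0n// ler_nat !ltnS ltnn.
by [].
Qed.

Lemma branch_dist0 x y : branch_dist x y = 0 -> x = y.
Proof.
case: (branch_dist_cases x y) => [[_]|[n ->]]// /eqP.
by rewrite invr_eq0 pnatr_eq0.
Qed.

Lemma branch_dist_sym x y : branch_dist x y = branch_dist y x.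
Proof.
have H u v : branch_dist u v <= branch_dist v u.
  case: (branch_dist_cases v u) => [[_ ->]|[n e]]; first by rewrite !branch_distxx.
  rewrite e; apply/branch_dist_le => i ni.
  by have /branch_dist_le -> : branch_dist v u <= n.+1%:R^-1 by rewrite e.
by apply/eqP; rewrite eq_le !H.
Qed.

Lemma branch_dist_triangle y x z : branch_dist x z <= branch_dist x y + branch_dist y z.
Proof.
case: (branch_dist_cases x y) => [[-> ->]|[n en]]; first by rewrite add0r.
case: (branch_dist_cases y z) => [[-> <-]|[m em]]; first by rewrite addr0.
have /branch_dist_le axy : branch_dist x y <= n.+1%:R^-1 by rewrite en.
have /branch_dist_le ayz : branch_dist y z <= m.+1%:R^-1 by rewrite em.
have [nm|/ltnW mn] := leqP n m.
  apply: le_trans (_ : n.+1%:R^-1 <= _); last by rewrite en lerDl branch_dist_ge0.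
  by apply/branch_dist_le => i ni; rewrite axy// ayz// (leq_trans ni).
apply: le_trans (_ : m.+1%:R^-1 <= _); last by rewrite em lerDr branch_dist_ge0.
by apply/branch_dist_le => i mi; rewrite axy ?ayz// (leq_trans mi).
Qed.

End BranchMetric.

(** An alias of T that remembers the coding, so that the metric can be attached
    to it. *)
Definition branch_space (R : realType) (T : Type) (theta : T -> baire)
  (theta_inj : injective theta) : Type := T.

Section BranchSpace.
Variables (R : realType) (T : Type) (theta : T -> baire).
Hypothesis theta_inj : injective theta.
Let M := branch_space R theta_inj.

HB.instance Definition _ := gen_eqMixin M.
HB.instance Definition _ := gen_choiceMixin M.
HB.instance Definition _ := isMetric.Build R M
  (branch_distxx R theta_inj) (branch_dist0 theta_inj)
  (branch_dist_sym R theta_inj) (branch_dist_triangle R theta_inj).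

Hypothesis theta_closed :
  forall v, (forall n, exists t, agree n v (theta t)) -> exists t, v = theta t.

Let r_small (e : R) : 0 < e -> exists n, n.+1%:R^-1 < e.
Proof. by move=> /ltr_add_invr[k]; rewrite add0r; exists k. Qed.

Let distE (x y : M) n : (mdist x y <= n.+1%:R^-1) <-> agree n (theta x) (theta y).
Proof. exact: branch_dist_le. Qed.

Let ball_agree (x y : M) n : ball x n.+1%:R^-1 y -> agree n (theta x) (theta y).
Proof. by rewrite ballEmdist/= => /ltW/distE. Qed.

Let agree_ball (x : M) (e : R) : 0 < e -> exists n,
  forall y, agree n (theta x) (theta y) -> ball x e y.
Proof.
move=> /r_small[n ne]; exists n => y /distE xy.
by rewrite ballEmdist/= (le_lt_trans xy).
Qed.

Lemma open_prefix_of s : open ([set x | prefix_of s (theta x)] : set M).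
Proof.
rewrite openE => x /= sx; apply/nbhs_ballP; exists (size s).+1%:R^-1.
  by rewrite /= invr_gt0 ltr0n.
by move=> y /ball_agree a i si; rewrite sx// a.
Qed.

Lemma branch_space_polish : polish_metric M.
Proof.
split.
  pose f s : option M := if pselect (exists x, prefix_of s (theta x)) is left e
    then Some (projT1 (cid e)) else None.
  have fnd s x : f s = Some x -> prefix_of s (theta x).
    by rewrite /f; case: pselect => // e [<-]; exact: (projT2 (cid e)).
  exists [set x | exists s, f s = Some x].
    apply/countable_injP.
    exists (fun x => if pselect (exists s, f s = Some x) is left e
                     then pickle (projT1 (cid e)) else 0%N).
    move=> x y; rewrite !in_setE /= => Dx Dy.
    case: pselect => // ex; case: pselect => // ey.
    case: (cid ex) => s fs; case: (cid ey) => t ft /= /(pcan_inj pickleK) st.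
    by move: fs; rewrite st ft => -[].
  move=> O [x Ox]; rewrite openE => /(_ x Ox) /nbhs_ballP[e /= e0 eO].
  have [n hn] := agree_ball x e0.
  pose s := mkseq (theta x) n.
  have [y fy] : exists y, f s = Some y.
    rewrite /f; case: pselect => [h|[]]; first by exists (projT1 (cid h)).
    by exists x; exact: prefix_of_mkseq.
  exists y; split; last by exists s.
  apply/eO/hn => i ni; have := fnd _ _ fy i.
  by rewrite size_mkseq nth_mkseq// => ->.
move=> F FF cF.
have fx n : exists x : M, F (ball x n.+1%:R^-1).
  by move/cauchyP : cF; apply; rewrite invr_gt0 ltr0n.
pose x n := projT1 (cid (fx n)).
have Fx n : F (ball (x n) n.+1%:R^-1) := projT2 (cid (fx n)).
have meet m n : exists y, agree m (theta (x m)) (theta y) /\ agree n (theta (x n)) (theta y).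
  have [y [/ball_agree h1 /ball_agree h2]] := filter_ex (filterI (Fx m) (Fx n)).
  by exists y.
have [l xl] : exists l, (fun i => theta (x i.+1) i) = theta l.
  apply: theta_closed => n; exists (x n) => i ni.
  by have [y [h1 h2]] := meet i.+1 n; rewrite h1// h2.
have al n : agree n (theta l) (theta (x n)).
  move=> i ni; rewrite -xl.
  by have [y [h1 h2]] := meet i.+1 n; rewrite h1// h2.
exists l; apply/fcvg_ballP => e /(agree_ball l)[n h].
apply: filterS (Fx n) => y /ball_agree xy; apply: h => i ni.
by rewrite (al n)// xy.
Qed.

Lemma branch_space_borel : <<s @open M >> = preimage_system (theta : M -> baire) borelN.
Proof.
apply/seteqP; split.
  apply: smallest_sub; first by apply: preimage_system_sa; exact: borelN_sa.
  move=> O oO.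
  exists (fun u => exists s, prefix_of s u /\ ([set x | prefix_of s (theta x)] : set M) `<=` O).
    apply: (sa_exC borelN_sa) => [|s]; first exact: countableP.
    by apply: (sa_and borelN_sa); [exact: borel_prefix_of|exact: sa_cst borelN_sa _].
  apply/predeqP => x; split=> [[s [sx]]|Ox]; first by apply.
  move: oO; rewrite openE => /(_ x Ox) /nbhs_ballP[e /= e0 eO].
  have [n hn] := agree_ball x e0.
  exists (mkseq (theta x) n); split; first exact: prefix_of_mkseq.
  move=> y /= yn; apply/eO/hn => i ni; have := yn i.
  by rewrite size_mkseq nth_mkseq// => ->.
apply: preimage_system_sub; first exact: smallest_sigma_algebra.
move=> n m.
suff : <<s @open M >> (fun t : M => exists s,
    nth 0%N s n = m /\ (n < size s)%N /\ prefix_of s (theta t)).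
  apply: sa_ext => t; split=> [[s [<- [ns st]]]|tn]; first by rewrite st.
  exists (mkseq (theta t) n.+1); rewrite nth_mkseq// size_mkseq; split=> //.
  by split=> //; exact: prefix_of_mkseq.
have hS := smallest_sigma_algebra setT (@open M).
apply: (sa_exC hS) => [|s]; first exact: countableP.
apply: (sa_and hS); first exact: sa_cst hS _.
apply: (sa_and hS); first exact: sa_cst hS _.
by apply: sub_sigma_algebra; exact: open_prefix_of.
Qed.

End BranchSpace.

(** The metric comes from the pair made of the code and of its witness in
    [borel_closed_graph].  These pairs form a closed set, whereas the codes alone
    are only Borel. *)
Lemma coded_polish (R : realType) (T : Type) (S : set (set T)) : coded S ->
  exists (M : metricType R) (f : T -> M),
    [/\ polish_metric M, bijective f & S = [set f @^-1` B | B in <<s @open M >>]].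
Proof.
move=> [phi [iphi /borel_closed_graph[C [w [cC bw Cw]]] ->]].
pose theta t := join (phi t) (w (phi t)).
have itheta : injective theta.
  by move=> x y /(congr1 evens); rewrite !evens_join => /iphi.
have ctheta v : (forall n, exists t, agree n v (theta t)) -> exists t, v = theta t.
  move=> H; have : C (evens v) (odds v).
    apply: cC => n; have [t vt] := H n.*2; exists (phi t), (w (phi t)); split.
    - by rewrite -[phi t](evens_join _ (w (phi t))); exact: agree_evens.
    - by rewrite -[w _](odds_join (phi t)); exact: agree_odds.
    - by apply/Cw; split=> //; exists t.
  by move=> /Cw[[t _ et] ow]; exists t; rewrite /theta et -ow join_evens_odds.
exists (branch_space R itheta), (fun t => t); split.
- exact: branch_space_polish.
- by exists (fun t => t).
- change (preimage_system phi borelN =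
    preimage_system (fun t : T => t) <<s @open (branch_space R itheta) >>).
  rewrite branch_space_borel//; apply/seteqP; split.
  + move=> _ [B bB <-]; exists (theta @^-1` (fun z => B (evens z))).
      exists (fun z => B (evens z)) => //.
      by apply: (borel_fun_preimage borelN_sa _ bB); borel_fun_tac.
    by apply/predeqP => t; rewrite /preimage /= /theta evens_join.
  + move=> _ [_ [B bB <-] <-]; exists (fun u => B (join u (w u))) => //.
    apply: (borel_fun_preimage borelN_sa _ bB); apply: borel_fun_join; first exact: borel_fun_id.
    exact: bw.
Qed.

Definition coded_space (R : realType) (T : Type) (S : set (set T)) (cS : coded S) :
  standardBorelType R := StandardBorelType (coded_polish R cS).

Local Close Scope ring_scope.

(** * Finitely supported equivariant permutations *)

Section FinitaryPerm.
Variable G : groupType.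

(** The translation action of G on countably many copies of itself. *)
Definition left_shift (g : G) (k : G * nat) : G * nat := ((g * k.1)%g, k.2).

(** The restricted wreath product of G by the finitary symmetric group of nat,
    presented as the automorphisms of the free G-set G * nat that fix all but
    finitely many orbits pointwise.  In this form freeness at a frame is injectivity
    of the frame. *)
Record finperm := FinPerm {
  fwd : G * nat -> G * nat ;
  bwd : G * nat -> G * nat ;
  fwdK : cancel fwd bwd ;
  bwdK : cancel bwd fwd ;
  fwd_left_shift : forall g k, fwd (left_shift g k) = left_shift g (fwd k) ;
  fwd_support : exists n, forall k, (n <= k.2)%N -> fwd k = k
}.

Lemma finperm_eq (p q : finperm) : fwd p =1 fwd q -> p = q.
Proof.
case: p q => [f f' fK f'K sf nf] [h h' hK h'K sh nh] /= fh.
have {}fh : f = h by apply/funext.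
subst h; have bb : f' = h' by apply/funext => k; rewrite -[in LHS](h'K k) fK.
by subst h'; congr FinPerm; exact: Prop_irrelevance.
Qed.

Lemma bwd_left_shift (p : finperm) g k : bwd p (left_shift g k) = left_shift g (bwd p k).
Proof. by rewrite -[in LHS](bwdK p k) -fwd_left_shift fwdK. Qed.

Lemma bwd_support (p : finperm) : exists n, forall k, (n <= k.2)%N -> bwd p k = k.
Proof.
by have [n pn] := fwd_support p; exists n => k /pn kp; rewrite -[in LHS]kp fwdK.
Qed.

Definition finperm1 : finperm.
Proof. by apply: (@FinPerm id id) => //; exists 0. Defined.

Definition finpermV (p : finperm) : finperm :=
  FinPerm (bwdK p) (fwdK p) (bwd_left_shift p) (bwd_support p).

Definition finpermM (p q : finperm) : finperm.
Proof.
apply: (@FinPerm (fwd p \o fwd q) (bwd q \o bwd p)).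
- by move=> k /=; rewrite !fwdK.
- by move=> k /=; rewrite !bwdK.
- by move=> g k /=; rewrite !fwd_left_shift.
- have [n pn] := fwd_support p; have [m qm] := fwd_support q.
  exists (maxn n m) => k; rewrite geq_max => /andP[nk mk] /=.
  by rewrite qm// pn.
Defined.

HB.instance Definition _ := gen_eqMixin finperm.
HB.instance Definition _ := gen_choiceMixin finperm.

Lemma finpermA : associative finpermM. Proof. by move=> *; exact: finperm_eq. Qed.
Lemma finperm1g : left_id finperm1 finpermM. Proof. by move=> *; exact: finperm_eq. Qed.
Lemma finpermg1 : right_id finperm1 finpermM. Proof. by move=> *; exact: finperm_eq. Qed.
Lemma finpermVg : left_inverse finperm1 finpermV finpermM.
Proof. by move=> p; apply: finperm_eq => k /=; rewrite fwdK. Qed.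
Lemma finpermgV : right_inverse finperm1 finpermV finpermM.
Proof. by move=> p; apply: finperm_eq => k /=; rewrite bwdK. Qed.

HB.instance Definition _ :=
  isGroup.Build finperm finpermA finperm1g finpermg1 finpermVg finpermgV.

(** By equivariance, a permutation is determined by its values at the points
    (1, i) for i below a bound of its support. *)
Lemma countable_finperm : countable [set: G] -> countable [set: finperm].
Proof.
case/countable_injP => num inum.
pose c (k : G * nat) := pickle (num k.1, k.2).
have cinj : injective c.
  move=> [g k] [g' k'] /(pcan_inj pickleK)[gg' ->]; congr pair.
  by apply: inum; rewrite ?in_setT.
pose N (p : finperm) := projT1 (cid (fwd_support p)).
have NP p k : (N p <= k.2)%N -> fwd p k = k by exact: (projT2 (cid (fwd_support p))).
apply/countable_injP.
exists (fun p => pickle (mkseq (fun i => c (fwd p (1%g, i))) (N p))).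
move=> p q _ _ /(pcan_inj pickleK) pq.
have Npq : N p = N q by move: (congr1 size pq); rewrite !size_mkseq.
apply: finperm_eq => -[g i].
case: (leqP (N p) i) => Ni; first by rewrite !NP// -Npq.
have -> : (g, i) = left_shift g (1%g, i) by rewrite /left_shift /= mulg1.
rewrite !fwd_left_shift; congr left_shift; apply: cinj.
by move: (congr1 (nth 0 ^~ i) pq); rewrite !nth_mkseq// -Npq.
Qed.

End FinitaryPerm.

(** * From a reduction to a free action to essential freeness *)

Section Product.
Variables (T1 T2 : Type) (S1 : set (set T1)) (S2 : set (set T2)).
Hypotheses (h1 : sigma_algebra setT S1) (h2 : sigma_algebra setT S2).

Lemma prod_sa : sigma_algebra setT (prod_sigma_algebra S1 S2).
Proof. exact: smallest_sigma_algebra. Qed.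

Lemma prod_fst A : S1 A -> prod_sigma_algebra S1 S2 (fun p => A p.1).
Proof.
move=> SA; apply: sub_sigma_algebra; exists A => //; exists setT.
  exact: (sa_cst h2 True).
by apply/predeqP => p; split=> // -[].
Qed.

Lemma prod_snd A : S2 A -> prod_sigma_algebra S1 S2 (fun p => A p.2).
Proof.
move=> SA; apply: sub_sigma_algebra; exists setT; first exact: (sa_cst h1 True).
by exists A => //; apply/predeqP => p; split=> // -[].
Qed.

Lemma borel_fun_fst f : borel_fun S1 f -> borel_fun (prod_sigma_algebra S1 S2) (fun p => f p.1).
Proof. by move=> bf n m; exact: (prod_fst (bf n m)). Qed.

Lemma borel_fun_snd f : borel_fun S2 f -> borel_fun (prod_sigma_algebra S1 S2) (fun p => f p.2).
Proof. by move=> bf n m; exact: (prod_snd (bf n m)). Qed.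

Lemma prod_preimage T (S : set (set T)) (f : T -> T1) (g : T -> T2) P :
  sigma_algebra setT S -> (forall A, S1 A -> S (f @^-1` A)) ->
  (forall A, S2 A -> S (g @^-1` A)) -> prod_sigma_algebra S1 S2 P ->
  S (fun t => P (f t, g t)).
Proof.
move=> hS hf hg; apply: (sa_generated_preimage (f := fun t => (f t, g t)) hS).
by move=> _ [A SA [B SB <-]]; exact: (sa_and hS (hf A SA) (hg B SB)).
Qed.

End Product.

Lemma prod_coded T1 T2 (phi1 : T1 -> baire) (phi2 : T2 -> baire) P :
  prod_sigma_algebra (preimage_system phi1 borelN) (preimage_system phi2 borelN) P ->
  exists2 B, borelN B & forall x y, P (x, y) <-> B (join (phi1 x) (phi2 y)).
Proof.
move=> hP; suff [B bB BP] : preimage_system (fun p => join (phi1 p.1) (phi2 p.2)) borelN P.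
  by exists B => // x y; rewrite -BP.
move: P hP; apply: smallest_sub; first by apply: preimage_system_sa; exact: borelN_sa.
move=> _ [_ [A bA <-] [_ [B bB <-] <-]].
exists (fun z => A (evens z) /\ B (odds z)).
  apply: (sa_and borelN_sa); first by apply: (borel_fun_preimage borelN_sa _ bA); borel_fun_tac.
  by apply: (borel_fun_preimage borelN_sa _ bB); borel_fun_tac.
by apply/predeqP => -[x y]; rewrite /preimage /= !joinE.
Qed.

(** Partial functions instead of total ones: T2 may be empty, and a section may
    be empty. *)
Lemma lusin_novikov_coded T1 T2 (S1 : set (set T1)) (S2 : set (set T2))
    (P : T1 -> T2 -> Prop) : coded S1 -> coded S2 ->
  prod_sigma_algebra S1 S2 (fun p => P p.1 p.2) ->
  (forall x, countable [set y | P x y]) ->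
  exists e : nat -> T1 -> option T2,
    (forall k B, S2 B -> S1 (fun x => exists2 y, e k x = Some y & B y)) /\
    forall x y, P x y <-> exists k, e k x = Some y.
Proof.
move=> [phi1 [i1 r1 ->]] [phi2 [i2 r2 ->]] /prod_coded[B bB BP] cP.
pose Q z := range phi1 (evens z) /\ range phi2 (odds z) /\ B z.
have bQ : borelN Q.
  apply: (sa_and borelN_sa); first by apply: (borel_fun_preimage borelN_sa _ r1); borel_fun_tac.
  by apply: (sa_and borelN_sa) => //; apply: (borel_fun_preimage borelN_sa _ r2); borel_fun_tac.
have QP x v : Q (join (phi1 x) v) <-> exists2 y, v = phi2 y & P x y.
  rewrite /Q !joinE; split=> [[_ [[y _ <-] /BP Pxy]]|[y -> Pxy]]; first by exists y.
  by split; [exists x|split; [exists y|apply/BP]].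
have cQ u : countable [set v | Q (join u v)].
  case: (pselect (range phi1 u)) => [[x _ <-]|nu].
    apply: sub_countable (cP x); apply: card_le_trans (card_image_le phi2 _).
    by apply: subset_card_le => v /QP[y -> Pxy]; exists y.
  apply: sub_countable (countable0 baire); apply: subset_card_le => v [].
  by rewrite !joinE.
have [U [bU UQ]] := lusin_novikov bQ cQ.
pose e k x := if pselect (exists y, U k (phi1 x) = phi2 y /\ P x y) is left h
  then Some (projT1 (cid h)) else None.
have eE k x y : e k x = Some y <-> U k (phi1 x) = phi2 y /\ P x y.
  rewrite /e; case: pselect => [h|nh]; last by split=> // h; case: nh; exists y.
  case: (cid h) => z [Uz Pz] /=; split=> [[<-]//|[Uy Py]].
  by congr Some; apply: i2; rewrite -Uz.
exists e; split=> [k _ [A bA <-]|x y].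
  have h1 := preimage_system_sa phi1 borelN_sa.
  have bp := @borel_fun_preimage_system _ phi1.
  have bUp : borel_fun (preimage_system phi1 borelN) (fun x => U k (phi1 x)) :=
    borel_fun_comp h1 bp (bU k).
  have := sa_and h1 (borel_fun_preimage h1 (borel_fun_join bp bUp) bQ)
    (borel_fun_preimage h1 bUp bA).
  apply: sa_ext => x; rewrite QP; split=> [[[y Uy Py] AU]|[y /eE[Uy Py] Ay]].
    by exists y; [apply/eE|rewrite /preimage/= -Uy].
  by split; [exists y|rewrite Uy].
split=> [Pxy|[k /eE[]//]].
have [|k Uk] := UQ (phi1 x) (phi2 y); first by apply/QP; exists y.
by exists k; apply/eE.
Qed.

Lemma coded_baire : coded borelN.
Proof.
exists id; split=> //.
  by apply: sa_ext (sa_cst borelN_sa True) => x; split=> // _; exists x.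
by apply/seteqP; split=> [B bB|_ [B bB <-]//]; exists B.
Qed.

Section BorelAction.
Variable R : realType.

Lemma borel_sa (X : standardBorelType R) : sigma_algebra setT (borel X).
Proof. exact/coded_sa/standard_coded. Qed.

Lemma cber_enum (X : standardBorelType R) (F : X -> X -> Prop) : cber F ->
  exists e : nat -> X -> X, (forall k, borel_map (e k)) /\
    forall x y, F x y <-> exists k, e k x = y.
Proof.
move=> [eqF bF cF].
have [e [be eF]] := lusin_novikov_coded (standard_coded X) (standard_coded X) bF cF.
have hS := borel_sa X.
(* Where e k x is undefined, x itself is a point of its class. *)
exists (fun k x => odflt x (e k x)); split=> [k B bB|x y].
  have bT : borel X (fun=> True) := sa_cst hS True.
  have := sa_or hS (be k B bB) (sa_and hS (sa_not hS (be k _ bT)) bB).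
  apply: sa_ext => x; rewrite /preimage /=; case: (e k x) => [y|] /=; split.
  - by case=> [[z [->]]//|[[]]]; exists y.
  - by left; exists y.
  - by case=> [[]|[]].
  - by right; split=> // -[].
rewrite eF; split=> -[k]; first by move=> ek; exists k; rewrite ek.
case E : (e k x) => [z|] /= <-; first by exists k.
by apply/eF; reflexivity.
Qed.

(** The free space is Z, the saturation of the image of b.  The pairs
    (psi (h . b x), x) form a Borel set whose sections over the first coordinate lie
    in one F-class, so they are countable.  The Lusin-Novikov theorem then shows that
    the code of Z is Borel, and provides r choosing, for z in Z, a point x with z in
    the orbit of b x; r is the reduction back to F.  Stabilizers are conjugate along
    an orbit, so freeness at the points b x gives freeness on Z. *)
Lemma essentially_free_of_action (X : standardBorelType R) (F : X -> X -> Prop)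
    (H : groupType) (W : Type) (act : H -> W -> W) (psi : W -> baire) (b : X -> W) :
  cber F -> countable [set: H] -> injective psi ->
  (forall w, act 1%g w = w) -> (forall g h w, act (g * h)%g w = act g (act h w)) ->
  (forall h, borel_fun (preimage_system psi borelN) (fun w => psi (act h w))) ->
  borel_fun (borel X) (fun x => psi (b x)) ->
  (forall x x', F x x' <-> exists h, act h (b x) = b x') ->
  (forall h x, act h (b x) = b x -> h = 1%g) ->
  essentially_free F.
Proof.
move=> cF cH ipsi a1 aM bact bb bF bfree.
have hX := borel_sa X.
have aK h : cancel (act h) (act h^-1%g) by move=> w; rewrite -aM mulVg a1.
have bhb h : borel_fun (borel X) (fun x => psi (act h (b x))).
  move=> n m; have [B bB BE] := bact h n m.
  have := borel_fun_preimage hX bb bB; apply: sa_ext => x.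
  by rewrite -[B _]/((psi @^-1` B) (b x)) BE.
pose Q u x := exists h, u = psi (act h (b x)).
have bQ : prod_sigma_algebra borelN (borel X) (fun p => Q p.1 p.2).
  apply: (sa_exC (prod_sa _ _) (A := fun h p => p.1 = psi (act h (b p.2))) cH) => h.
  apply: (borel_fun_eq (prod_sa _ _)); first exact: (borel_fun_fst hX borel_fun_id).
  exact: (borel_fun_snd borelN_sa (bhb h)).
have QF u x x' : Q u x -> Q u x' -> F x x'.
  move=> [h ->] [h' /ipsi hh']; apply/bF; exists (h'^-1 * h)%g.
  by rewrite aM hh' aK.
have cQ u : countable [set x | Q u x].
  case: (pselect (exists x, Q u x)) => [[x Qx]|nQ].
    apply: sub_countable (cber_countable cF x); apply: subset_card_le => y /= Qy.
    exact: QF Qx Qy.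
  apply: sub_countable (countable0 X); apply: subset_card_le => x /= Qx.
  by apply: nQ; exists x.
have [e [be eQ]] := lusin_novikov_coded coded_baire (standard_coded X) bQ cQ.
pose Z := {w : W | exists x h, act h (b x) = w}.
pose phi (z : Z) := psi (projT1 z).
have iphi : injective phi.
  by move=> [w hw] [w' hw'] /ipsi /= ww'; subst w'; congr exist; exact: Prop_irrelevance.
have bT : borel X (fun=> True) := sa_cst hX True.
have cZ : coded (preimage_system phi borelN).
  exists phi; split=> //.
  apply: (sa_ext _ (sa_ex borelN_sa (fun k => be k _ bT))) => u; split.
    move=> [k [x /(ex_intro _ k)/eQ[h ->] _]].
    by exists (exist _ (act h (b x)) (ex_intro _ x (ex_intro _ h erefl))).
  move=> [[w [x [h hw]]] _ <-].
  have /eQ[k ek] : Q (phi (exist _ w (ex_intro _ x (ex_intro _ h hw)))) x.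
    by exists h; rewrite /phi/= hw.
  by exists k, x.
pose ZX := coded_space R cZ.
have hZ : sigma_algebra setT (borel ZX) := coded_sa cZ.
have bphi : borel_fun (borel ZX) phi := @borel_fun_preimage_system _ phi.
have actP h (z : Z) : exists x h', act h' (b x) = act h (projT1 z).
  by case: z => w [x [h' hw]]; exists x, (h * h')%g; rewrite aM hw.
pose actZ h (z : ZX) : ZX := exist _ (act h (projT1 z)) (actP h z).
have valZ (z z' : Z) : projT1 z = projT1 z' -> z = z'.
  by move=> zz'; apply: iphi; rewrite /phi zz'.
have bactZ h : borel_fun (borel ZX) (fun z => phi (actZ h z)).
  move=> n m; have [B bB BE] := bact h n m.
  have := borel_fun_preimage hZ bphi bB; apply: sa_ext => z.
  by rewrite -[B _]/((psi @^-1` B) (projT1 z)) BE.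
pose S (z z' : ZX) := exists h, actZ h z = z'.
have cS : cber S.
  split.
  - split.
    + by move=> z; exists 1%g; apply: valZ; rewrite /= a1.
    + by move=> z _ [h <-]; exists h^-1%g; apply: valZ; rewrite /= aK.
    + move=> z _ _ [h <-] [h' <-]; exists (h' * h)%g; apply: valZ.
      by rewrite /= aM.
  - apply: (sa_exC (prod_sa _ _) (A := fun h p => actZ h p.1 = p.2) cH) => h.
    have := borel_fun_eq (prod_sa _ _) (borel_fun_fst hZ (bactZ h)) (borel_fun_snd hZ bphi).
    by apply: sa_ext => -[z z'] /=; split=> [/iphi//|->].
  - move=> z; apply: sub_countable cH.
    apply: card_le_trans (card_image_le (fun h => actZ h z) _).
    by apply: subset_card_le => _ [h <-]; exists h.
have freeS : free_cber S.
  split=> //; exists H, actZ; split=> //; split.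
  - by move=> z; apply: valZ; rewrite /= a1.
  - by move=> g h z; apply: valZ; rewrite /= aM.
  - move=> _ [B bB <-].
    have hT : sigma_algebra setT [set: set H] by [].
    have : prod_sigma_algebra [set: set H] (borel ZX)
        (fun p => exists h, p.1 = h /\ B (phi (actZ h p.2))).
      apply: (sa_exC (prod_sa _ _) (A := fun h p => p.1 = h /\ B (phi (actZ h p.2))) cH) => h.
      apply: (sa_and (prod_sa _ _)).
        exact: (prod_fst hZ (A := fun g => g = h)).
      exact: (prod_snd hT (borel_fun_preimage hZ (bactZ h) bB)).
    by apply: sa_ext => -[h z] /=; split=> [[_ [<-]]//|Bz]; exists h.
  - move=> g [w [x [h hw]]] /(congr1 (fun z : Z => projT1 z)) /= gw.
    have : (h^-1 * (g * h))%g = 1%g by apply: (bfree _ x); rewrite !aM hw gw -hw aK.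
    move=> /(congr1 (fun k => h * k * h^-1)%g).
    by rewrite !mulgA mulgV mul1g mulgK mulg1 mulgV.
exists ZX, S; split=> //; split.
  exists (fun x => exist _ (b x) (ex_intro _ x (ex_intro _ 1%g (a1 _)))); split.
    by move=> _ [B bB <-]; exact: (borel_fun_preimage hX bb bB).
  move=> x x'; rewrite bF; split=> -[h hb]; exists h.
    exact: valZ.
  by have /(congr1 (fun z : Z => projT1 z)) := hb.
have ez (z : ZX) : exists k, exists x, e k (phi z) = Some x.
  case: z => w [x [h hw]].
  have /eQ[k ek] : Q (phi (exist _ w (ex_intro _ x (ex_intro _ h hw)))) x.
    by exists h; rewrite /phi/= hw.
  by exists k, x.
have ezb z : exists k, isSome (e k (phi z)).
  by have [k [x ek]] := ez z; exists k; rewrite ek.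
(* r z is the first point that the enumeration e finds for the code of z. *)
have rP z : exists x, e (ex_minn (ezb z)) (phi z) = Some x.
  by case: ex_minnP => k; case: (e k (phi z)) => // x; exists x.
pose r (z : ZX) : X := projT1 (cid (rP z)).
have rE z : e (ex_minn (ezb z)) (phi z) = Some (r z) := projT2 (cid (rP z)).
have rF z : exists h, act h (b (r z)) = projT1 z.
  have /eQ[h /ipsi hz] : exists k, e k (phi z) = Some (r z) by eexists; exact: rE.
  by exists h.
exists r; split=> [B bB|z z'].
  have beZ k A : borel X A -> borel ZX (fun z => exists2 x, e k (phi z) = Some x & A x).
    by move=> bA; exact: (borel_fun_preimage hZ bphi (be k A bA)).
  have := sa_ex hZ (fun k => sa_and hZ (beZ k B bB) (sa_all hZ (fun j =>
    sa_or hZ (sa_cst hZ (~ (j < k)%N)) (sa_not hZ (beZ j _ bT))))).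
  apply: sa_ext => z; rewrite /preimage /=; split=> [[k [[x ek Bx] mink]]|Br].
    suff kz : ex_minn (ezb z) = k by move: (rE z); rewrite kz ek => -[<-].
    case: ex_minnP => k' ek' mink'; apply/eqP; rewrite eqn_leq mink' ?ek//=.
    rewrite leqNgt; apply/negP => k'k; case: (mink k') => // ne; apply: ne.
    by case: (e k' (phi z)) ek' => // y _; exists y.
  exists (ex_minn (ezb z)); split; first by exists (r z).
  move=> j; case: (pselect (j < ex_minn (ezb z))%N) => jk; [right|by left].
  move=> [x ej _]; move: jk; case: ex_minnP => k _ /(_ j); rewrite ej => /(_ isT).
  by rewrite leqNgt => /negP.
have [h hz] := rF z; have [h' hz'] := rF z'.
split=> [[g gz]|/bF[g gr]].
  apply/bF; exists (h'^-1 * (g * h))%g.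
  by rewrite !aM hz -[act g _]/(projT1 (actZ g z)) gz -hz' aK.
exists (h' * (g * h^-1))%g; apply: valZ.
change (act (h' * (g * h^-1))%g (projT1 z) = projT1 z').
by rewrite -hz' -gr !aM -hz aK.
Qed.

End BorelAction.

(** * Frames of a class of F *)

Section Rank.
Implicit Type p : pred nat.

(** When p k holds, this is the position of k in p. *)
Definition rank p k := count p (iota 0 k).

Lemma rankS p k : rank p k.+1 = (rank p k + p k)%N.
Proof. by rewrite /rank -addn1 iotaD count_cat /= addn0. Qed.

Lemma rank_mono p k l : (k <= l)%N -> (rank p k <= rank p l)%N.
Proof. by move=> kl; rewrite -(subnKC kl) /rank iotaD count_cat leq_addr. Qed.

Lemma rank_inj p k l : p k -> p l -> rank p k = rank p l -> k = l.
Proof.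
have H i j : p i -> rank p i = rank p j -> (j <= i)%N.
  move=> pi ij; rewrite leqNgt; apply/negP => /(rank_mono p).
  by rewrite rankS pi addn1 ij ltnn.
by move=> pk pl kl; apply/eqP; rewrite eqn_leq !H.
Qed.

Lemma rank_surj p N r : (forall k, (N <= k)%N -> p k) -> exists2 k, p k & rank p k = r.
Proof.
move=> pN; have rN m : (m <= rank p (N + m))%N.
  elim: m => // m IH; rewrite addnS rankS pN ?leq_addr// addn1 ltnS.
  exact: IH.
have ex : exists k, (r < rank p k)%N by exists (N + r.+1)%N; exact: rN.
case: (ex_minnP ex) => -[|k]; first by [].
rewrite rankS => rk /(_ k) mk; have kr : (rank p k <= r)%N.
  by rewrite leqNgt; apply/negP => /mk; rewrite ltnn.
have pk : p k by move: rk; case: (p k) => //; rewrite addn0 ltnNge kr.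
by exists k => //; apply/eqP; rewrite eqn_leq kr; move: rk; rewrite pk addn1 ltnS.
Qed.

Lemma rankC p k : (rank p k + rank (predC p) k = k)%N.
Proof. by rewrite /rank count_predC size_iota. Qed.

Lemma rank_le p q k (m : nat -> nat) :
  (forall i, (i < k)%N -> p i -> (m i < k)%N && q (m i)) ->
  (forall i j, p i -> p j -> m i = m j -> i = j) -> (rank p k <= rank q k)%N.
Proof.
move=> mq minj; rewrite /rank -!size_filter -(size_map m).
apply: uniq_leq_size.
  rewrite map_inj_in_uniq ?filter_uniq ?iota_uniq// => i j.
  by rewrite !mem_filter => /andP[pi _] /andP[pj _]; exact: minj.
move=> ? /mapP[i]; rewrite mem_filter mem_iota => /andP[pi /= ik] ->.
by have /andP[h1 h2] := mq i ik pi; rewrite mem_filter h2 mem_iota.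
Qed.

End Rank.

Lemma finite_nat_bound (A : set nat) : finite_set A ->
  exists N, forall k, (N <= k)%N -> ~ A k.
Proof.
case/finite_seqP => s ->; exists (\max_(i <- s) i).+1 => k Nk /= ks.
by move: Nk; rewrite ltnNge leq_bigmax_seq.
Qed.

Section Encoding.
Variables (R : realType) (X : standardBorelType R) (E F : X -> X -> Prop).
Hypotheses (hE : cber E) (hF : cber F) (EF : forall x y, E x y -> F x y).
Hypothesis fin : finite_index E F.
Variable e : nat -> X -> X.
Hypothesis be : forall k, borel_map (e k).
Hypothesis eF : forall x y, F x y <-> exists k, e k x = y.
Variables (Y : standardBorelType R) (S : Y -> Y -> Prop) (f : X -> Y).
Hypothesis hf : borel_reduction E S f.
Variables (G : groupType) (act : G -> Y -> Y).
Hypothesis hact : free_borel_action act.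
Hypothesis actS : forall x y, S x y <-> exists g, act g x = y.

Let K := (G * nat)%type.

Let Erefl x : E x x. Proof. by have [[]] := hE. Qed.
Let Esym x y : E x y -> E y x. Proof. by case: hE => -[_ h _] _ _; exact: h. Qed.
Let Etrans x y z : E x y -> E y z -> E x z.
Proof. by case: hE => -[_ _ h] _ _; exact: h. Qed.
Let Fsym x y : F x y -> F y x. Proof. by case: hF => -[_ h _] _ _; exact: h. Qed.
Let Ftrans x y z : F x y -> F y z -> F x z.
Proof. by case: hF => -[_ _ h] _ _; exact: h. Qed.
Let hX := borel_sa X.

Let F_e k x : F x (e k x). Proof. by apply/eF; exists k. Qed.

(** The selected indices pick exactly one point in each E-class inside the
    F-class of x. *)
Definition first_rep x k := `[< forall j, (j < k)%N -> ~ E (e j x) (e k x) >].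

Lemma first_rep_inj x j k : first_rep x j -> first_rep x k -> E (e j x) (e k x) -> j = k.
Proof.
have H i l : first_rep x l -> E (e i x) (e l x) -> (l <= i)%N.
  by move=> /asboolP h il; rewrite leqNgt; apply/negP => /h.
by move=> hj hk jk; apply/eqP; rewrite eqn_leq (H j k)// (H k j)//; exact: Esym.
Qed.

Lemma first_rep_exists x y : F x y -> exists2 k, first_rep x k & E (e k x) y.
Proof.
move=> /eF[k <-]; elim/ltn_ind: k => k IH.
case: (pselect (forall j, (j < k)%N -> ~ E (e j x) (e k x))) => [hk|].
  by exists k => //; exact/asboolP.
move=> /existsNP[j /not_implyP[jk /contrapT ejk]].
by have [l hl el] := IH j jk; exists l => //; exact: Etrans ejk.
Qed.

(** Distinct selected indices yield distinct E-classes inside one F-class. *)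
Lemma first_rep_finite x : exists N, forall k, (N <= k)%N -> ~~ first_rep x k.
Proof.
suff : finite_set [set k | first_rep x k].
  by move=> /finite_nat_bound[N HN]; exists N => k /HN/negP.
pose g (C : set X) := if pselect (exists k, first_rep x k /\ C (e k x)) is left h
  then projT1 (cid h) else 0.
apply: sub_finite_set (finite_image g (fin x)) => k /= hk.
exists [set z | E (e k x) z]; first by exists (e k x) => //; exact: F_e.
rewrite /g; case: pselect => [h|[]]; last by exists k; split=> //; exact: Erefl.
by case: (cid h) => j /= [hj kj]; apply/esym; exact: first_rep_inj kj.
Qed.

Let old x : pred nat := predC (first_rep x).

(** Selected indices go to the orbit of the corresponding point of Y; the
    remaining indices are renumbered without gaps, so that every dummy orbit is used
    whatever the number of selected indices. *)
Definition frame x (k : K) : Y + K :=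
  if first_rep x k.2 then inl (act k.1 (f (e k.2 x))) else inr (k.1, rank (old x) k.2).

Lemma act_E g g' x x' : act g (f x) = act g' (f x') -> E x x'.
Proof.
move=> gg'; apply/(proj2 hf)/actS; exists (g'^-1 * g)%g.
by rewrite (actM hact) gg' -(actM hact) mulVg (act1 hact).
Qed.

Lemma frame_inj x : injective (frame x).
Proof.
move=> [g k] [g' k']; rewrite /frame /=.
case: ifP => hk; case: ifP => hk' //= [].
  move=> gg'; have kk' := first_rep_inj hk hk' (act_E gg').
  rewrite -kk' in gg' *; congr pair.
  have : (g'^-1 * g)%g = 1%g.
    apply: (act_free hact (x := f (e k x))).
    by rewrite (actM hact) gg' -(actM hact) mulVg (act1 hact).
  by move=> /(congr1 (fun u => g' * u)%g); rewrite mulgA mulgV mul1g mulg1.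
by move=> -> /rank_inj ->//; rewrite /old /= ?hk ?hk'.
Qed.

Definition translate (g : G) (u : Y + K) : Y + K :=
  match u with inl y => inl (act g y) | inr k => inr (left_shift g k) end.

Lemma frame_left_shift x g k : frame x (left_shift g k) = translate g (frame x k).
Proof. by rewrite /frame /=; case: ifP => _ //=; rewrite (actM hact). Qed.

(** The image of the frame depends on the F-class only. *)
Lemma frame_sub x x' k : F x x' -> exists k', frame x k = frame x' k'.
Proof.
case: k => g k Fxx'; rewrite /frame /=; case: ifP => hk.
  have [|k' hk' ekk'] := @first_rep_exists x' (e k x).
    by apply: Ftrans (F_e k x); exact: Fsym.
  have /actS[g' gg'] : S (f (e k' x')) (f (e k x)) by apply/(proj2 hf).
  by exists ((g * g')%g, k'); rewrite /= hk' -gg' (actM hact).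
have [N HN] := first_rep_finite x'.
have [k' hk' <-] := @rank_surj (old x') N (rank (old x) k) HN.
by exists (g, k'); move: hk'; rewrite /old /= => /negbTE ->.
Qed.

(** Beyond a bound of the selected indices of x', the count for x is at most the
    count for x', since each selected point of x has an E-equivalent selected point
    for x'. *)
Lemma rank_first_rep_le x x' N : F x x' ->
  (forall k, (N <= k)%N -> ~~ first_rep x' k) ->
  (rank (first_rep x) N <= rank (first_rep x') N)%N.
Proof.
move=> Fxx' HN.
have H k : exists2 k', first_rep x' k' & E (e k' x') (e k x).
  by apply: first_rep_exists; apply: Ftrans (F_e k x); exact: Fsym.
pose m k := projT1 (cid2 (H k)).
have [hm em] : (forall k, first_rep x' (m k)) /\ (forall k, E (e (m k) x') (e k x)).
  by split=> k; rewrite /m; case: cid2.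
apply: (@rank_le _ _ _ m) => [i iN _|i j hi hj ij].
  by rewrite hm andbT ltnNge; apply/negP => /HN; rewrite hm.
apply: first_rep_inj hi hj _; apply: Etrans (em j); rewrite -ij.
exact/Esym/em.
Qed.

(** Both points select the same number of indices, namely the number of
    E-classes in their F-class; so the unselected indices beyond all selected ones
    are renumbered in the same way. *)
Lemma frame_tail x x' : F x x' -> exists N, forall k : K, (N <= k.2)%N -> frame x k = frame x' k.
Proof.
move=> Fxx'; have [N HN] := first_rep_finite x; have [N' HN'] := first_rep_finite x'.
exists (maxn N N') => -[g k] /=; rewrite geq_max => /andP[Nk N'k].
rewrite /frame /= (negbTE (HN k Nk)) (negbTE (HN' k N'k)); congr (inr (_, _)).
have rr : rank (first_rep x) k = rank (first_rep x') k.
  apply/eqP; rewrite eqn_leq; apply/andP; split; apply: rank_first_rep_le => //.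
  - by move=> l kl; apply: HN'; exact: leq_trans kl.
  - exact: Fsym.
  - by move=> l kl; apply: HN; exact: leq_trans kl.
have := rankC (first_rep x) k; rewrite -[RHS](rankC (first_rep x') k) rr.
exact: addnI.
Qed.

(** The permutation sends k to the place where the other frame takes the value
    of the first one at k.  Equivariance and finiteness of the support come from
    those of the frames, by injectivity. *)
Lemma frame_perm x x' : F x x' -> exists p : finperm G, forall k, frame x' k = frame x (bwd p k).
Proof.
move=> Fxx'.
pose t y y' (h : F y y') k := projT1 (cid (frame_sub k h)).
have tE y y' (h : F y y') k : frame y k = frame y' (t y y' h k) :=
  projT2 (cid (frame_sub k h)).
pose Fx'x := Fsym Fxx'.
have tK : cancel (t x x' Fxx') (t x' x Fx'x).
  by move=> k; apply: (@frame_inj x); rewrite -!tE.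
have tK' : cancel (t x' x Fx'x) (t x x' Fxx').
  by move=> k; apply: (@frame_inj x'); rewrite -!tE.
have ts g k : t x x' Fxx' (left_shift g k) = left_shift g (t x x' Fxx' k).
  by apply: (@frame_inj x'); rewrite -tE !frame_left_shift -tE.
have tf : exists n, forall k : K, (n <= k.2)%N -> t x x' Fxx' k = k.
  have [N HN] := frame_tail Fxx'; exists N => k /HN Nk.
  by apply: (@frame_inj x'); rewrite -tE.
by exists (FinPerm tK tK' ts tf) => k /=; rewrite -tE.
Qed.

(** Index 0 is always selected, so the second frame has a value in Y, and
    that value can only come from a point of Y in the first frame. *)
Lemma frame_F x x' (s : K -> K) : (forall k, frame x' k = frame x (s k)) -> F x x'.
Proof.
move=> /(_ (1%g, 0)); rewrite /frame /=.
have -> : first_rep x' 0 by apply/asboolP.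
case: ifP => // _ [/act_E/EF h].
by apply: (Ftrans (F_e (s (1%g, 0)).2 x)); apply: Fsym; apply: Ftrans h; exact: F_e.
Qed.

Variables (phi : Y -> baire) (num : K -> nat).
Hypotheses (phi_inj : injective phi) (num_inj : injective num).
Hypothesis borel_fun_phi : borel_fun (borel Y) phi.

(** The first term tells the two summands apart. *)
Definition orbit_code (u : Y + K) : baire :=
  match u with
  | inl y => fun j => if j is j'.+1 then phi y j' else 0
  | inr k => fun j => if j is _.+1 then num k else 1
  end.

Lemma orbit_code_inj : injective orbit_code.
Proof.
move=> [y|k] [y'|k'] /= h.
- congr inl; apply: phi_inj; apply/funext => j.
  exact: (congr1 (fun u => u j.+1) h).
- by have := congr1 (fun u => u 0) h.
- by have := congr1 (fun u => u 0) h.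
- by congr inr; apply: num_inj; exact: (congr1 (fun u => u 1) h).
Qed.

Definition frame_code (w : K -> Y + K) : baire := fun n =>
  if pselect (exists k, num k = (Cantor.of_nat n).1) is left h
  then orbit_code (w (projT1 (cid h))) (Cantor.of_nat n).2 else 0.

Lemma frame_codeE w k j : frame_code w (Cantor.to_nat (num k, j)) = orbit_code (w k) j.
Proof.
rewrite /frame_code Cantor.cancel_of_to; case: pselect => [h|[]]; last by exists k.
by case: (cid h) => k' /= /num_inj ->.
Qed.

Lemma frame_code_inj : injective frame_code.
Proof.
move=> w w' ww'; apply/funext => k; apply: orbit_code_inj; apply/funext => j.
by rewrite -!frame_codeE ww'.
Qed.

Lemma borel_fun_frame_code T (B : set (set T)) (w : T -> K -> Y + K) : sigma_algebra setT B ->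
  (forall k, borel_fun B (fun t => orbit_code (w t k))) -> borel_fun B (fun t => frame_code (w t)).
Proof.
move=> hB bw n m; rewrite /frame_code; case: pselect => h; last exact: sa_cst.
exact: bw.
Qed.

Definition permute (p : finperm G) (w : K -> Y + K) : K -> Y + K := w \o bwd p.

Lemma borel_fun_permute p :
  borel_fun (preimage_system frame_code borelN) (fun w => frame_code (permute p w)).
Proof.
apply: borel_fun_frame_code; first by apply: preimage_system_sa; exact: borelN_sa.
move=> k j m.
have := @borel_fun_preimage_system _ frame_code (Cantor.to_nat (num (bwd p k), j)) m.
by apply: sa_ext => w; rewrite frame_codeE.
Qed.

Let E_meas j k : borel X (fun x => E (e j x) (e k x)).
Proof.
exact: (prod_preimage hX (@be j) (@be k) (cber_borel hE)).
Qed.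

Let first_rep_meas k : borel X (fun x => first_rep x k).
Proof.
have := sa_all hX (fun j => sa_or hX (sa_cst hX (~ (j < k)%N)) (sa_not hX (E_meas j k))).
apply: sa_ext => x; split=> [H|/asboolP H j].
  by apply/asboolP => j jk; case: (H j).
by case: (pselect (j < k)%N) => jk; [right; exact: H|left].
Qed.

Let rank_meas k r : borel X (fun x => rank (old x) k = r).
Proof.
elim: k r => [|k IH] r; first exact: sa_cst hX (0 = r).
have := sa_or hX (sa_and hX (first_rep_meas k) (IH r))
  (sa_and hX (sa_not hX (first_rep_meas k))
     (sa_ex hX (fun s => sa_and hX (IH s) (sa_cst hX (s.+1 = r))))).
apply: sa_ext => x; rewrite rankS /old /=; case: (first_rep x k) => /=.
  by rewrite addn0; split=> [[[]|[]]|]//; left.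
rewrite addn1; split=> [[[]//|[_ [s [-> ->]]]]//|h]; right; split=> //.
by exists (rank (predC (first_rep x)) k).
Qed.

Let act_meas g A : borel Y A -> borel Y (act g @^-1` A).
Proof.
move=> bA; have hY := borel_sa Y.
apply: (prod_preimage (f := fun=> g) (g := fun y => y) hY _ _ (act_borel hact bA)) => //.
by move=> C _; exact: (sa_cst hY (C g)).
Qed.

Lemma borel_fun_frame : borel_fun (borel X) (fun x => frame_code (frame x)).
Proof.
apply: (borel_fun_frame_code hX) => -[g k] j m.
have h1 : borel X (fun x => orbit_code (inl (act g (f (e k x)))) j = m).
  case: j => [|j] /=; first exact: sa_cst hX (0 = m).
  exact: (be k (proj1 hf _ (act_meas g (borel_fun_phi j m)))).
have h2 : borel X (fun x => orbit_code (inr (g, rank (old x) k)) j = m).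
  have := sa_ex hX (fun r => sa_and hX (rank_meas k r)
    (sa_cst hX (orbit_code (inr (g, r)) j = m))).
  by apply: sa_ext => x; split=> [[r [-> ]]//|h]; exists (rank (old x) k).
have := sa_or hX (sa_and hX (first_rep_meas k) h1)
  (sa_and hX (sa_not hX (first_rep_meas k)) h2).
apply: sa_ext => x; rewrite /frame /=; case: (first_rep x k); split.
- by case=> -[].
- by left.
- by case=> -[].
- by right.
Qed.

End Encoding.

Theorem theorem1 (R : realType) (X : standardBorelType R)
  (E F : X -> X -> Prop) (hE : cber E) (hF : cber F)
  (hEF : forall x y, E x y -> F x y)
  (hfree : essentially_free E) (hindex : finite_index E F) :
  essentially_free F.
Proof.
have [Y [S [[_ [G [act [cG hact actS]]]] [[f hf] _]]]] := hfree.
have [e [be eF]] := cber_enum hF.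
have [phi [iphi _ bY]] := standard_coded Y.
have bphi : borel_fun (borel Y) phi by rewrite bY; exact: borel_fun_preimage_system.
have /countable_injP[num0 inum0] := cG.
pose num (k : G * nat) := pickle (num0 k.1, k.2).
have inum : injective num.
  move=> [g k] [g' k'] /(pcan_inj pickleK)[gg' ->]; congr pair.
  by apply: inum0; rewrite ?in_setT.
apply: (essentially_free_of_action (act := @permute R Y G) (psi := frame_code phi num)
  (b := frame E e f act)) => //.
- exact: countable_finperm.
- exact: frame_code_inj.
- exact: borel_fun_permute.
- exact: (borel_fun_frame hE be hf hact num bphi).
- move=> x x'; split=> [Fxx'|[p hp]].
    have [p hp] := frame_perm hE hF hindex eF hf hact actS Fxx'.
    by exists p; apply/esym/funext.

  apply: (frame_F hF hEF eF hf hact actS (s := bwd p)) => k.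
  by rewrite -hp.
- move=> p x hp; apply: finperm_eq => k.
  apply: (frame_inj hE hf hact actS (e := e) (x := x)).
  by rewrite -[in LHS]hp /permute /= fwdK.
Qed.
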